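(* Let $N\ge 5$ and let $(u^*,\lambda^* )$ be the extremal pair of $(P)_\lambda$ in the unit ball $B\subset\mathbb{R}^N$. If $u^*$ is singular (i.e. $\sup_B u^*=1$), then $$1-u^*(x)\le C_0|x|^{4/3}\qquad\text{in } B,$$ where $C_0:=\left(\frac{\lambda^*}{\bar\lambda}\right)^{1/3}$ and $\bar\lambda:=\frac{8\left(N-\frac23\right)\left(N-\frac83\right)}{9}$.
   Context: $B$ is the open unit ball in $\mathbb{R}^N$ and $\partial_\nu$ is the outward normal derivative on $\partial B$. For $\lambda>0$, problem $(P)_\lambda$ is $$\Delta^2 u=\frac{\lambda}{(1-u)^2}\ \text{in } B,\qquad 0<u<1\ \text{in } B,\qquad u=\partial_\nu u=0\ \text{on }\partial B.$$ Define $\lambda^*:=\sup\{\lambda>0:\ (P)_\lambda \text{ has a classical solution}\}$; it is known that $0<\lambda^*<\infty$. For each $0<\lambda<\lambda^*$ there is (known) a classical minimal solution $u_\lambda$ of $(P)_\lambda$, i.e. one lying below every other classical solution; it is radial and radially decreasing, and $\lambda\mapsto u_\lambda(x)$ is strictly increasing on $(0,\lambda^* )$ for each $x\in B$. The extremal solution is the pointwise limit $u^*(x):=\lim_{\lambda\nearrow\lambda^*}u_\lambda(x)$, and $(u^*,\lambda^* )$ is called the extremal pair. *)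

(* Defs.v *)
From HB Require Import structures.
From mathcomp Require Import all_boot all_order all_algebra.
From mathcomp Require Import all_classical all_reals all_analysis.

Set Implicit Arguments.
Unset Strict Implicit.
Unset Printing Implicit Defensive.

Import Order.TTheory GRing.Theory Num.Theory.
Import numFieldNormedType.Exports.

Local Open Scope classical_set_scope.
Local Open Scope ring_scope.

Section Biharmonic.
Context {R : realType} {N : nat}.
Implicit Types (u f g : 'rV[R]_N -> R) (U : set 'rV[R]_N) (x : 'rV[R]_N).

(* The norm that the library puts on 'rV[R]_N is the sup norm; it induces the
   same topology as this one. *)
Definition enorm x : R := Num.sqrt (\sum_(i < N) x ord0 i ^+ 2).

Definition unit_ball : set 'rV[R]_N := [set x | enorm x < 1].
Definition unit_cball : set 'rV[R]_N := [set x | enorm x <= 1].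
Definition unit_sphere : set 'rV[R]_N := [set x | enorm x = 1].

Definition basis_vec (i : 'I_N) : 'rV[R]_N := delta_mx ord0 i.

Definition partial (i : 'I_N) f : 'rV[R]_N -> R := 'D_(basis_vec i) f.

Definition laplacian f : 'rV[R]_N -> R :=
  fun x => \sum_(i < N) partial i (partial i f) x.

Definition bilaplacian f : 'rV[R]_N -> R := laplacian (laplacian f).

(* Meant for U open: the values of the partial derivatives on U then depend
   only on f restricted to U. *)
Fixpoint Ck_on (k : nat) U f : Prop :=
  {in U, continuous f} /\
  if k is k'.+1 then
    forall i : 'I_N,
      (forall x, U x -> derivable f x (basis_vec i)) /\ Ck_on k' U (partial i f)
  else True.

(* C^1 up to the boundary: f is continuous on the closed ball and its first
   partial derivatives on the open ball extend continuously to the closed one. *)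
Definition C1_cball f : Prop :=
  [/\ {within unit_cball, continuous f},
      Ck_on 1 unit_ball f &
      forall i : 'I_N, exists2 g, {within unit_cball, continuous g} &
        forall x, unit_ball x -> partial i f x = g x].

(* The outward unit normal at x on the unit sphere is x itself; the difference
   quotient is taken from inside the ball, hence h < 0. *)
Definition is_normal_derivative f x (d : R) : Prop :=
  (f (x + h *: x) - f x) / h @[h --> 0^'-] --> d.

Definition classical_solution (lambda : R) u : Prop :=
  [/\ Ck_on 4 unit_ball u, C1_cball u,
      forall x, unit_ball x -> bilaplacian u x = lambda / (1 - u x) ^+ 2,
      forall x, unit_ball x -> 0 < u x < 1 &
      forall x, unit_sphere x -> u x = 0 /\ is_normal_derivative u x 0].

Definition minimal_solution (lambda : R) u : Prop :=
  classical_solution lambda u /\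
  forall v, classical_solution lambda v ->
    forall x, unit_ball x -> u x <= v x.

Definition solvable_parameters : set R :=
  [set lambda | 0 < lambda /\ exists u, classical_solution lambda u].

(* [has_sup] makes [sup] the genuine supremum instead of a default value, i.e.
   it says that 0 < lambda_star < oo. *)
Definition extremal_pair (ustar : 'rV[R]_N -> R) (lambda_star : R) : Prop :=
  [/\ has_sup solvable_parameters,
      lambda_star = sup solvable_parameters &
      exists ul : R -> 'rV[R]_N -> R,
        (forall lambda, 0 < lambda < lambda_star ->
           minimal_solution lambda (ul lambda)) /\
        (forall x, unit_ball x ->
           ul lambda x @[lambda --> lambda_star^'-] --> ustar x)].

Definition singular (ustar : 'rV[R]_N -> R) : Prop :=
  sup [set ustar x | x in unit_ball] = 1.

End Biharmonic.

Definition lambda_bar (R : realType) (N : nat) : R :=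
  8 * (N%:R - 2 / 3) * (N%:R - 8 / 3) / 9.

(* Main.v *)
Require Import Defs.
From mathcomp Require Import all_boot all_order all_algebra.
From mathcomp Require Import all_classical all_reals all_analysis.
From mathcomp Require Import ring lra.

Set Implicit Arguments.
Unset Strict Implicit.
Unset Printing Implicit Defensive.

Import Order.TTheory GRing.Theory Num.Theory.
Import numFieldNormedType.Exports.

Local Open Scope classical_set_scope.
Local Open Scope ring_scope.

(** Write [U r = 1 - C * r ^ (4/3)].  Away from the origin [U (enorm x)] solves
    the equation with parameter [C ^ 3 * lambda_bar], so [C0] is the constant
    for which this parameter is [lambda_star].  Suppose that the bound fails at
    some [x]; then it fails there for some [C > C0], and for every [lambda]
    close enough to [lambda_star] the minimal solution [u] of parameter
    [lambda] satisfies [u x < U (enorm x)].  The claim is that [u 0] is then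
    bounded away from [1] uniformly in [lambda].  As [u] is largest at the
    centre, [ustar 0 < 1] bounds [ustar], against [ustar] being singular.

    The centre is bounded by a supersolution lying above [u].  Minimal
    solutions are radial (minimal_solution_radial): composing [u] with an
    orthogonal map gives another solution, which [u] minorizes.  Follow the
    profile of [u] outwards from [enorm x] until it first meets [U], at a
    radius [rho], or until [rho = 1]; there [u <= U] while [U' <= u'] for the
    radial derivatives.  On the ball of radius [rho] put
        [V = (1 - e) * U + e * P],
    where [P] is the biharmonic polynomial [a - b * r ^ 2] with the value and
    the derivative of [U] at [rho].  The inequality of arithmetic and geometric
    means gives [P <= U], hence [V <= U], and [V] is a supersolution for
    [lambda <= (1 - e) * C ^ 3 * lambda_bar]; the factor [1 - e] is paid for by
    [C > C0].  Unlike [U] it satisfies [V 0 < 1], by the amount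
    [e * C / 3 * rho ^ (4/3) >= e * C / 3 * enorm x ^ (4/3)]
    (center_bound).

    Two facts give [u <= V].  The bilaplacian has a comparison principle for
    radial functions on a ball (polar_comparison): [f >= 0] with a nonnegative
    boundary value and a nonpositive boundary slope forces [w >= 0] and
    [w' <= 0].  Since [1 / (1 - u) ^ 2] increases with [u], it cannot be
    applied to [V] and [u] directly.  Instead [u] is compared with the Picard
    iterates [w_0 = 0], [w_(k+1) = G (lambda / (1 - w_k) ^ 2)], where [G] solves
    the Dirichlet problem on the unit ball.  By comparison the iterates
    increase with [k] and satisfy [w_k <= u] and [w_k' >= u'].  At [rho] the
    data of [V] therefore dominate those of every iterate, and [w_k <= V] by
    induction (picard_le_barrier).  The limit of the iterates is a classical
    solution (picard_fixpoint, green_classical_solution), so it lies above the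
    minimal solution [u], which gives [u <= V] (minimal_solution_barrier).

    The operator [G] is explicit: the radial Laplacian [w'' + n * w' / r] in
    dimension [n + 1] is inverted by integrating [t ^ n * f], dividing by
    [r ^ n] and integrating again.  Everything is phrased with the averages
    [r ^ (- m - 1) * \int_0^r t ^ m * f], which stay regular at the origin. *)

(** * One-variable calculus *)

Section DerivativeRules.
Context {R : realType} {V : normedModType R}.
Implicit Types (f g : V -> R) (x v : V) (c df dg : R).

Lemma is_derive_add f g x v df dg : is_derive x v f df -> is_derive x v g dg ->
  is_derive x v (fun y => f y + g y) (df + dg).
Proof. by move=> ? ?; exact: is_deriveD. Qed.

Lemma is_derive_sub f g x v df dg : is_derive x v f df -> is_derive x v g dg ->
  is_derive x v (fun y => f y - g y) (df - dg).
Proof. by move=> ? ?; exact: is_deriveB. Qed.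

Lemma is_derive_mul f g x v df dg : is_derive x v f df -> is_derive x v g dg ->
  is_derive x v (fun y => f y * g y) (df * g x + f x * dg).
Proof.
move=> hf hg; apply: (@is_derive_eq _ _ _ (f * g) _ _ _ (f x *: dg + g x *: df)).
by rewrite addrC /GRing.scale /= [g x * _]mulrC.
Qed.

Lemma is_derive_scale c f x v df : is_derive x v f df ->
  is_derive x v (fun y => c * f y) (c * df).
Proof. by move=> ?; exact: is_deriveZ. Qed.

Lemma is_derive_const c x v : is_derive x v (fun=> c : R) 0.
Proof. exact: is_derive_cst. Qed.

Lemma is_derive_big_sum (I : Type) (s : seq I) (F : I -> V -> R) x v (D : I -> R) :
  (forall a, is_derive x v (F a) (D a)) ->
  is_derive x v (fun y => \sum_(a <- s) F a y) (\sum_(a <- s) D a).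
Proof.
move=> h; elim: s => [|a s IH].
  by under eq_fun do rewrite big_nil; rewrite big_nil; exact: is_derive_cst.
under eq_fun do rewrite big_cons; rewrite big_cons; exact: is_derive_add.
Qed.

End DerivativeRules.
Arguments is_derive_const {R V} c x {v}.

Section RealDerivatives.
Context {R : realType}.
Implicit Types (f : R -> R) (a b x : R) (n : nat).

Lemma is_derive_pow n x : is_derive x 1 (fun y : R => y ^+ n) (n%:R * x ^+ n.-1).
Proof.
apply: DeriveDef; first exact: exprn_derivable.
by rewrite exp_derive /GRing.scale /= mulr1 mulr_natl.
Qed.

Lemma is_derive_continuous f x (df : R) : is_derive x 1 f df -> {for x, continuous f}.
Proof.
by move=> [d _]; apply/differentiable_continuous/derivable1_diffP.
Qed.

Lemma le_of_derive_ge0 f (df : R -> R) a b : a <= b ->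
  {within `[a, b], continuous f} ->
  (forall x, a < x < b -> is_derive x 1 f (df x)) ->
  (forall x, a < x < b -> 0 <= df x) -> f a <= f b.
Proof.
rewrite le_eqVlt => /predU1P[<- //|ab] fc fd df0.
have [c] := MVT ab (fun x xab => fd x xab) fc.
rewrite in_itv /= => cab e; rewrite -subr_ge0 e mulr_ge0 ?df0 // subr_ge0 ltW //.
Qed.

Lemma eq_of_derive_eq0 f a b : a <= b ->
  {within `[a, b], continuous f} ->
  (forall x, a < x < b -> is_derive x 1 f 0) -> f a = f b.
Proof.
rewrite le_eqVlt => /predU1P[<- //|ab] fc fd.
have [c _] := MVT ab (fun x xab => fd x xab) fc.
by rewrite mul0r => /eqP; rewrite subr_eq0 => /eqP.
Qed.

End RealDerivatives.

(** * Weighted moments and averages over intervals from the origin *)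

Section Moments.
Context {R : realType}.
Implicit Types (f g : R -> R) (b c r t : R) (m : nat).
Notation mu := (@lebesgue_measure R).

Definition moment m f r : R := \int[mu]_(t in `[0, r]) (t ^+ m * f t).

(** The value for [r <= 0] is the limit at [0], which makes the average of a
    continuous function continuous on the whole line. *)
Definition average m f r : R :=
  if 0 < r then moment m f r / r ^+ m.+1 else f 0 / m.+1%:R.

Lemma continuous_pow_mul m f : continuous f -> continuous (fun t : R => t ^+ m * f t).
Proof. by move=> cf x; apply: cvgM; [exact: exprn_continuous|exact: cf]. Qed.

Lemma integrable_pow_mul m f (b : R) : continuous f ->
  mu.-integrable `[0, b] (EFin \o (fun t => t ^+ m * f t)).
Proof.
move=> cf; apply: continuous_compact_integrable; first exact: segment_compact.
by apply: continuous_subspaceT; exact: continuous_pow_mul.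
Qed.

Lemma is_derive_moment m f r : continuous f -> 0 < r ->
  is_derive r 1 (moment m f) (r ^+ m * f r).
Proof.
move=> cf r0.
have [|//|d e] := @continuous_FTC1_closed R (fun t => t ^+ m * f t) 0 r (r + 1)
  _ (integrable_pow_mul m _ cf) r0; first by rewrite ltrDl.
  exact: continuous_pow_mul.
by apply: DeriveDef; [exact: d|rewrite -derive1E e].
Qed.

Lemma moment_le0 m f r : r <= 0 -> moment m f r = 0.
Proof.
rewrite le_eqVlt => /predU1P[->|r0].
  by rewrite /moment set_itv1 Rintegral_set1.
by rewrite /moment set_itv_ge ?Rintegral_set0 // bnd_simp -ltNge.
Qed.

Lemma continuous_moment m f : continuous f -> continuous (moment m f).
Proof.
move=> cf r.
have [r0|r0|r0] := ltgtP r 0.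
- apply: (@near_cst_continuous _ _ 0).
  by near=> s; rewrite moment_le0 //; apply: ltW; near: s; exact: lt_nbhsl.
- exact/is_derive_continuous/is_derive_moment.
subst r.
apply/left_right_continuousP; rewrite moment_le0 //; split.
  by apply: cvg_near_cst; near=> s; rewrite moment_le0 //; near: s; exact: nbhs_left_le.
have := parameterized_integral_continuous ler01 (@integrable_pow_mul m f 1 cf).
move=> /(continuous_within_itvP _ ltr01)[_ + _].
by rewrite -[parameterized_integral _ _ _ _]/(moment m f 0) (moment_le0 m f (lexx 0)).
Unshelve. all: by end_near. Qed.

Lemma is_derive_pow_div m r :
  is_derive r 1 (fun t : R => t ^+ m.+1 / m.+1%:R) (r ^+ m).
Proof.
have h := is_derive_scale (m.+1%:R^-1) (is_derive_pow m.+1 r).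
have -> : (fun t : R => t ^+ m.+1 / m.+1%:R) = (fun t => m.+1%:R^-1 * t ^+ m.+1).
  by apply/funext => t; rewrite mulrC.
apply: (is_derive_eq h); rewrite mulrA mulVf ?mul1r //.
Qed.

Lemma moment_le m f c r : continuous f -> 0 < r ->
  (forall t, 0 < t < r -> f t <= c) -> moment m f r <= c * (r ^+ m.+1 / m.+1%:R).
Proof.
move=> cf r0 fc; rewrite -subr_ge0.
pose F t := c * (t ^+ m.+1 / m.+1%:R) - moment m f t.
have F0 : F 0 = 0 by rewrite /F expr0n /= mul0r mulr0 moment_le0 // subrr.
rewrite -/(F r) -F0.
apply: (@le_of_derive_ge0 _ _ (fun t => c * t ^+ m - t ^+ m * f t)).
- exact: ltW.
- apply: continuous_subspaceT => t; apply: cvgB; last exact: continuous_moment.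
  apply: cvgMr; apply: cvgMl; exact: exprn_continuous.
- move=> t /andP[t0 _]; apply: is_derive_sub; last exact: is_derive_moment.
  exact/is_derive_scale/is_derive_pow_div.
- move=> t /andP[t0 tr]; rewrite [c * _]mulrC -mulrBr; apply: mulr_ge0.
    by rewrite exprn_ge0 // ltW.
  by rewrite subr_ge0 fc // t0.
Qed.

Lemma moment_ge m f c r : continuous f -> 0 < r ->
  (forall t, 0 < t < r -> c <= f t) -> c * (r ^+ m.+1 / m.+1%:R) <= moment m f r.
Proof.
move=> cf r0 fc; rewrite -subr_ge0.
pose F t := moment m f t - c * (t ^+ m.+1 / m.+1%:R).
have F0 : F 0 = 0 by rewrite /F expr0n /= mul0r mulr0 moment_le0 // subrr.
rewrite -/(F r) -F0.
apply: (@le_of_derive_ge0 _ _ (fun t => t ^+ m * f t - c * t ^+ m)).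
- exact: ltW.
- apply: continuous_subspaceT => t; apply: cvgB; first exact: continuous_moment.
  apply: cvgMr; apply: cvgMl; exact: exprn_continuous.
- move=> t /andP[t0 _]; apply: is_derive_sub; first exact: is_derive_moment.
  exact/is_derive_scale/is_derive_pow_div.
- move=> t /andP[t0 tr]; rewrite [c * _]mulrC -mulrBr; apply: mulr_ge0.
    by rewrite exprn_ge0 // ltW.
  by rewrite subr_ge0 fc // t0.
Qed.

Lemma averageE m f r : 0 < r -> average m f r = moment m f r / r ^+ m.+1.
Proof. by rewrite /average => ->. Qed.

Lemma moment_average m f r : 0 <= r -> moment m f r = r ^+ m.+1 * average m f r.
Proof.
rewrite le_eqVlt => /predU1P[<-|r0]; first by rewrite moment_le0 // expr0n mul0r.
by rewrite averageE // mulrC divfK // expf_neq0 // gt_eqF.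
Qed.

Lemma average_le m f c r : continuous f -> 0 < r ->
  (forall t, 0 < t < r -> f t <= c) -> average m f r <= c / m.+1%:R.
Proof.
move=> cf r0 fc; rewrite averageE // ler_pdivrMr ?exprn_gt0 //.
by rewrite -mulrA [_^-1 * _]mulrC; exact: moment_le.
Qed.

Lemma average_ge m f c r : continuous f -> 0 < r ->
  (forall t, 0 < t < r -> c <= f t) -> c / m.+1%:R <= average m f r.
Proof.
move=> cf r0 fc; rewrite averageE // ler_pdivlMr ?exprn_gt0 //.
by rewrite -mulrA [_^-1 * _]mulrC; exact: moment_ge.
Qed.

Lemma continuous_average m f : continuous f -> continuous (average m f).
Proof.
move=> cf r.
have [r0|r0|r0] := ltgtP r 0.
- apply: (@near_cst_continuous _ _ (f 0 / m.+1%:R)).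
  near=> s; rewrite /average ifF //; apply/negbTE; rewrite -leNgt ltW //.
  by near: s; exact: lt_nbhsl.
- rewrite /continuous_at averageE //.
  have h : moment m f s / s ^+ m.+1 @[s --> r] --> moment m f r / r ^+ m.+1.
    apply: cvgM; first exact: continuous_moment.
    apply: cvgV; first by rewrite expf_neq0 // gt_eqF.
    exact: exprn_continuous.
  apply: cvg_trans h; apply: near_eq_cvg; near=> s; rewrite averageE //.
  by near: s; exact: lt_nbhsr.
subst r; rewrite /continuous_at {2}/average ltxx.
apply/cvgrPdist_le => e e0.
have [d /= d0 hd] : \forall t \near 0, `|f 0 - f t| < e.
  by have /cvgrPdist_lt /(_ _ e0) := cf 0.
near=> s; have [s0|s0] := leP s 0.
  by rewrite /average ltNge s0 /= subrr normr0 ltW.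
have hf t : 0 < t < s -> `|f 0 - f t| < e.
  move=> /andP[t0 ts]; apply: hd; rewrite /ball_ /= sub0r normrN gtr0_norm //.
  apply: (lt_trans ts); near: s; exact: lt_nbhsl.
have e' : e / m.+1%:R <= e by rewrite ler_pdivrMr // ler_peMr ?(ltW e0) // ler1n.
rewrite distrC; apply: le_trans e'; rewrite ler_norml; apply/andP; split.
  rewrite lerBrDl -mulNr -mulrDl; apply: average_ge => // t /hf.
  by rewrite ltr_norml => /andP[]; lra.
rewrite lerBlDl -mulrDl; apply: average_le => // t /hf.
by rewrite ltr_norml => /andP[]; lra.
Unshelve. all: by end_near. Qed.

(** Integration by parts of [t ^ m * f t].  The derivative of [f] is written
    [t * f1 t], the form that the derivatives of smooth radial profiles take at
    the origin. *)
Lemma average_parts m f f1 b r : continuous f -> continuous f1 ->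
  (forall t, 0 < t < b -> is_derive t 1 f (t * f1 t)) -> 0 <= r -> r <= b ->
  m.+1%:R * average m f r + r ^+ 2 * average m.+2 f1 r = f r.
Proof.
move=> cf cf1 fd; rewrite le_eqVlt => /predU1P[<- _|r0 rb].
  by rewrite /average ltxx expr0n /= mul0r addr0 mulrC divfK.
pose F t := t ^+ m.+1 * f t - m.+1%:R * moment m f t - moment m.+2 f1 t.
have : F 0 = F r.
  apply: eq_of_derive_eq0; first exact: ltW.
    apply: continuous_subspaceT => t.
    apply: cvgB; last exact: continuous_moment.
    apply: cvgB; last by apply: cvgMr; exact: continuous_moment.
    exact: continuous_pow_mul.
  move=> t /andP[t0 tr].
  have h1 := is_derive_mul (is_derive_pow m.+1 t) (fd t _).
  have h2 := is_derive_scale m.+1%:R (is_derive_moment m cf t0).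
  apply: (is_derive_eq (is_derive_sub (is_derive_sub (h1 _) h2)
    (is_derive_moment m.+2 cf1 t0))); first by rewrite t0 (lt_le_trans tr).
  by rewrite /= !exprS; ring.
rewrite /F !(@moment_le0 _ _ 0) // expr0n /= mul0r mulr0 !subr0.
rewrite !moment_average ?ltW // => /eqP; rewrite eq_sym => /eqP e.
have rn : r ^+ m.+1 != 0 by rewrite expf_neq0 // gt_eqF.
apply: (mulfI rn); apply/eqP; rewrite -subr_eq0; apply/eqP.
rewrite -{}[RHS]oppr0 -{}e !exprS; ring.
Qed.

(** Averaging preserves the shape [t * f1 t] of the derivative and only raises
    the weight by two, so averages of smooth radial profiles can be
    differentiated again and again without singular terms. *)
Lemma is_derive_average m f f1 b r : continuous f -> continuous f1 ->
  (forall t, 0 < t < b -> is_derive t 1 f (t * f1 t)) -> 0 < r < b ->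
  is_derive r 1 (average m f) (r * average m.+2 f1 r).
Proof.
move=> cf cf1 fd /andP[r0 rb].
have h := is_derive_moment m cf r0.
have rn : r != 0 by rewrite gt_eqF.
have rmn : r ^+ m.+1 != 0 by rewrite expf_neq0.
have hv := @is_deriveV _ (fun s : R => s ^+ m.+1) r _ _ rmn (is_derive_pow m.+1 r).
have hm := is_derive_mul h hv.
have : \forall s \near r, moment m f s * (s ^+ m.+1)^-1 = average m f s.
  near=> s; rewrite averageE //; near: s; exact: lt_nbhsr.
move=> /near_eq_is_derive /(_ hm).
move=> hh; apply: (is_derive_eq hh).
have e := average_parts m cf cf1 fd (ltW r0) (ltW rb).
rewrite moment_average ?ltW // -e /GRing.scale /= !exprS.
field; by rewrite rn expf_neq0.
Unshelve. all: by end_near. Qed.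

End Moments.

(** * Comparison for the radial bilaplacian *)

Section PolarSystem.
Context {R : realType}.
Implicit Types (w p H q f : R -> R) (n : nat) (r rho c : R).

(** The equation that the profile [w] of a radial function has the profile [f]
    as its bilaplacian in dimension [n + 1], written as a first-order system:
    [H] is the profile of the Laplacian, and [t ^ n * p] and [t ^ n * q] are
    the fluxes of [w] and [H] through spheres.  The fluxes vanish at the origin
    when no mass sits there; this admits profiles that are singular at the
    origin, such as powers of [r]. *)
Record polar n rho w p H q f : Prop := Polar {
  polar_w : forall r, 0 < r < rho -> is_derive r 1 w (p r) ;
  polar_p : forall r, 0 < r < rho ->
    is_derive r 1 (fun t => t ^+ n * p t) (r ^+ n * H r) ;
  polar_H : forall r, 0 < r < rho -> is_derive r 1 H (q r) ;
  polar_q : forall r, 0 < r < rho ->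
    is_derive r 1 (fun t => t ^+ n * q t) (r ^+ n * f r) ;
  polar_p0 : t ^+ n * p t @[t --> 0^'+] --> (0 : R) ;
  polar_q0 : t ^+ n * q t @[t --> 0^'+] --> (0 : R) }.

Lemma le_of_derive_oo g (dg : R -> R) rho r s :
  (forall t, 0 < t < rho -> is_derive t 1 g (dg t)) ->
  0 < r -> r <= s -> s < rho -> (forall t, r < t < s -> 0 <= dg t) -> g r <= g s.
Proof.
move=> gd r0 rs srho dg0; apply: (@le_of_derive_ge0 _ _ dg) => //.
  apply: continuous_in_subspaceT => t; rewrite inE /= in_itv /= => /andP[rt ts].
  apply: (@is_derive_continuous _ _ _ (dg t)); apply: gd.
  by rewrite (lt_le_trans r0 rt) (le_lt_trans ts).
move=> t /andP[rt ts]; apply: gd.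
by rewrite (lt_trans r0 rt) (lt_trans ts).
Qed.

Lemma cvg_at_right_le g (a b l c : R) : a < b -> g t @[t --> a^'+] --> l ->
  (forall t, a < t < b -> c <= g t) -> c <= l.
Proof.
move=> ab gl gc; apply: (cvgr_to_ge gl); near=> t; apply: gc.
apply/andP; split; near: t; [exact: nbhs_right_gt|exact: nbhs_right_lt].
Unshelve. all: by end_near. Qed.

Lemma cvg_at_left_le g (a b l c : R) : a < b -> g t @[t --> b^'-] --> l ->
  (forall t, a < t < b -> c <= g t) -> c <= l.
Proof.
move=> ab gl gc; apply: (cvgr_to_ge gl); near=> t; apply: gc.
apply/andP; split; near: t; [exact: nbhs_left_gt|exact: nbhs_left_lt].
Unshelve. all: by end_near. Qed.

Lemma cvg_at_right_ge g (a b l c : R) : a < b -> g t @[t --> a^'+] --> l ->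
  (forall t, a < t < b -> g t <= c) -> l <= c.
Proof.
move=> ab gl gc; rewrite -lerN2; apply: (cvg_at_right_le ab (cvgN gl)) => t.
by move=> /gc; rewrite lerN2.
Qed.

Lemma cvg_at_left_ge g (a b l c : R) : a < b -> g t @[t --> b^'-] --> l ->
  (forall t, a < t < b -> g t <= c) -> l <= c.
Proof.
move=> ab gl gc; rewrite -lerN2; apply: (cvg_at_left_le ab (cvgN gl)) => t.
by move=> /gc; rewrite lerN2.
Qed.

Lemma polarB n rho w1 p1 H1 q1 f1 w2 p2 H2 q2 f2 :
  polar n rho w1 p1 H1 q1 f1 -> polar n rho w2 p2 H2 q2 f2 ->
  polar n rho (fun r => w1 r - w2 r) (fun r => p1 r - p2 r)
    (fun r => H1 r - H2 r) (fun r => q1 r - q2 r) (fun r => f1 r - f2 r).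
Proof.
have E (g h : R -> R) : (fun t => t ^+ n * (g t - h t)) =
    (fun t => t ^+ n * g t - t ^+ n * h t) by apply/funext => t; rewrite mulrBr.
move=> [a1 a2 a3 a4 a5 a6] [b1 b2 b3 b4 b5 b6]; split.
- by move=> r hr; apply: is_derive_sub; [exact: a1|exact: b1].
- move=> r hr; rewrite E mulrBr; apply: is_derive_sub; [exact: a2|exact: b2].
- by move=> r hr; apply: is_derive_sub; [exact: a3|exact: b3].
- move=> r hr; rewrite E mulrBr; apply: is_derive_sub; [exact: a4|exact: b4].
- by rewrite E; apply: cvg_trans (cvgB a5 b5) _; rewrite subr0.
- by rewrite E; apply: cvg_trans (cvgB a6 b6) _; rewrite subr0.
Qed.

(** The flux of [H] vanishes at the origin and increases, so [H] is
    nondecreasing.  If the flux of [w] becomes positive, then [H] was positive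
    before; from there on [H] stays positive and the flux keeps growing up to
    [rho], where its limit is nonpositive.  Hence [w] decreases towards its
    nonnegative boundary value. *)
Lemma polar_comparison n rho w p H q f (w1 p1 : R) :
  polar n rho w p H q f -> (forall r, 0 < r < rho -> 0 <= f r) ->
  w t @[t --> rho^'-] --> w1 -> 0 <= w1 ->
  p t @[t --> rho^'-] --> p1 -> p1 <= 0 ->
  forall r, 0 < r < rho -> p r <= 0 /\ 0 <= w r.
Proof.
move=> [wd pd Hd qd p0 q0] f0 ww w10 pp p10.
have q_ge0 r : 0 < r < rho -> 0 <= q r.
  move=> /andP[r0 rrho].
  rewrite -(pmulr_rge0 _ (exprn_gt0 n r0)).
  apply: (cvg_at_right_ge r0 q0) => t /andP[t0 tr].
  apply: (le_of_derive_oo qd) => //; first exact: ltW.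
  move=> s /andP[ts sr]; rewrite mulr_ge0 ?exprn_ge0 //.
    by apply: ltW; exact: lt_trans ts.
  by apply: f0; rewrite (lt_trans t0) ?(lt_trans sr).
have p_le0 r : 0 < r < rho -> p r <= 0.
  move=> /andP[r0 rrho]; rewrite leNgt; apply/negP => pr.
  have mr : 0 < r ^+ n * p r by rewrite mulr_gt0 ?exprn_gt0.
  have [c /andP[c0 cr] Hc] : exists2 c, 0 < c < r & 0 < H c.
    (* otherwise the flux of [w], which starts from [0], would decrease *)
    apply: contrapT => nH; move: mr; apply/negP; rewrite -leNgt.
    apply: (cvg_at_right_le r0 p0) => t /andP[t0 tr].
    rewrite -lerN2.
    apply: (@le_of_derive_oo (fun s => - (s ^+ n * p s))
      (fun s => - (s ^+ n * H s)) rho) => //.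
    + by move=> s hs; have := pd s hs => ?; exact: is_deriveN.
    + exact: ltW.
    + move=> s /andP[ts sr]; rewrite oppr_ge0 pmulr_rle0; last first.
        by rewrite exprn_gt0 // (lt_trans t0).
      rewrite leNgt; apply/negP => Hs; apply: nH; exists s => //.
      by rewrite (lt_trans t0).
  have pt t : r < t < rho -> r ^+ n * p r / rho ^+ n <= p t.
    move=> /andP[rt trho].
    have t0 := lt_trans r0 rt; have rho0 := lt_trans t0 trho.
    have mt : r ^+ n * p r <= t ^+ n * p t.
      apply: (le_of_derive_oo pd) => //; first exact: ltW.
      move=> s /andP[rs st]; have s0 := lt_trans r0 rs.
      apply: mulr_ge0; first by rewrite exprn_ge0 // ltW.
      apply: ltW; apply: (lt_le_trans Hc).
      apply: (le_of_derive_oo Hd) => //.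
      + by apply: ltW; exact: lt_trans rs.
      + exact: lt_trans trho.
      + move=> x /andP[cx xs]; apply: q_ge0; rewrite (lt_trans c0) //=.
        by rewrite (lt_trans xs) // (lt_trans st).
    rewrite ler_pdivrMr ?exprn_gt0 //; apply: (le_trans mt).
    have pt0 : 0 <= p t.
      rewrite -(pmulr_rge0 _ (exprn_gt0 n t0)); exact: le_trans (ltW mr) mt.
    rewrite mulrC ler_wpM2l // lerXn2r ?nnegrE //; exact: ltW.
  have := cvg_at_left_le rrho pp pt.
  apply/negP; rewrite -ltNge; apply: (le_lt_trans p10).
  by rewrite divr_gt0 // exprn_gt0 // (lt_trans r0).
move=> r /andP[r0 rrho]; split; first by apply: p_le0; rewrite r0.
apply: (le_trans w10); apply: (cvg_at_left_ge rrho ww) => t /andP[rt trho].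
rewrite -lerN2.
apply: (@le_of_derive_oo (fun s => - w s) (fun s => - p s) rho) => //.
+ by move=> s hs; have := wd s hs => ?; exact: is_deriveN.
+ exact: ltW.
+ move=> s /andP[rs st]; rewrite oppr_ge0; apply: p_le0.
  by rewrite (lt_trans r0) //= (lt_trans st).
Qed.

Lemma polar_le n rho w1 p1 H1 q1 f1 w2 p2 H2 q2 f2 (a1 a2 b1 b2 : R) :
  polar n rho w1 p1 H1 q1 f1 -> polar n rho w2 p2 H2 q2 f2 ->
  (forall r, 0 < r < rho -> f1 r <= f2 r) ->
  w1 t @[t --> rho^'-] --> a1 -> w2 t @[t --> rho^'-] --> a2 -> a1 <= a2 ->
  p1 t @[t --> rho^'-] --> b1 -> p2 t @[t --> rho^'-] --> b2 -> b2 <= b1 ->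
  forall r, 0 < r < rho -> w1 r <= w2 r /\ p2 r <= p1 r.
Proof.
move=> h1 h2 f12 wa1 wa2 a12 pb1 pb2 b12 r r01.
have wa : w2 t - w1 t @[t --> rho^'-] --> a2 - a1 by exact: cvgB.
have pb : p2 t - p1 t @[t --> rho^'-] --> b2 - b1 by exact: cvgB.
have f12' t : 0 < t < rho -> 0 <= f2 t - f1 t by move=> ht; rewrite subr_ge0 f12.
have := polar_comparison (polarB h2 h1) f12' wa _ pb _ r01.
by rewrite !subr_ge0 !subr_le0 => /(_ a12 b12)[].
Qed.

End PolarSystem.

(** * Bounded pointwise convergence *)

Section BoundedConvergence.
Context {R : realType}.
Implicit Types (F : nat -> R -> R) (f : R -> R) (m : nat) (b c r t : R).
Notation mu := (@lebesgue_measure R).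

Lemma moment_bound m f b r : continuous f -> 0 <= r <= 1 ->
  (forall t, 0 <= t <= 1 -> `|f t| <= b) -> `|moment m f r| <= b.
Proof.
move=> cf /andP[r0 r1] fb.
have b0 : 0 <= b by apply: le_trans (fb 0 _); rewrite ?lexx ?ler01.
have [r0'|r0'] := ltP 0 r; last by rewrite moment_le0 // normr0.
have fb' t : 0 < t < r -> - b <= f t <= b.
  move=> /andP[t0 tr]; rewrite -ler_norml; apply: fb.
  by rewrite (ltW t0) (le_trans (ltW tr)).
have rb : b * (r ^+ m.+1 / m.+1%:R) <= b.
  rewrite ler_piMr // ler_pdivrMr ?mul1r //.
  by apply: (@le_trans _ _ 1); rewrite ?ler1n // exprn_ile1.
rewrite ler_norml; apply/andP; split.
  rewrite lerNl; apply: le_trans rb; rewrite lerNl -mulNr.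
  by apply: moment_ge => // t /fb' /andP[].
by apply: le_trans rb; apply: moment_le => // t /fb' /andP[].
Qed.

Lemma average_bound m f b r : continuous f -> 0 <= r <= 1 ->
  (forall t, 0 <= t <= 1 -> `|f t| <= b) -> `|average m f r| <= b.
Proof.
move=> cf /andP[r0 r1] fb.
have b0 : 0 <= b by apply: le_trans (fb 0 _); rewrite ?lexx ?ler01.
have bm : b / m.+1%:R <= b by rewrite ler_pdivrMr // ler_peMr // ler1n.
have [r0'|r0'] := ltP 0 r; last first.
  rewrite /average ltNge r0' /= normrM normfV [`|_%:R|]ger0_norm //.
  apply: le_trans bm; rewrite ler_pM2r ?invr_gt0 //.
  by apply: fb; rewrite lexx ler01.
have fb' t : 0 < t < r -> - b <= f t <= b.
  move=> /andP[t0 tr]; rewrite -ler_norml; apply: fb.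
  by rewrite (ltW t0) (le_trans (ltW tr)).
rewrite ler_norml; apply/andP; split.
  rewrite lerNl; apply: le_trans bm; rewrite lerNl -mulNr.
  by apply: average_ge => // t /fb' /andP[].
by apply: le_trans bm; apply: average_le => // t /fb' /andP[].
Qed.

(** The hypotheses of dominated convergence on the unit interval, together with
    the continuity that moments and averages require. *)
Record bounded_cvg F f : Prop := BoundedCvg {
  bounded_cvg_cont : forall k, continuous (F k) ;
  bounded_cvg_lim_cont : continuous f ;
  bounded_cvg_bound : exists b, forall k t, 0 <= t <= 1 -> `|F k t| <= b ;
  bounded_cvg_lim : forall t, 0 <= t <= 1 -> F k t @[k --> \oo] --> f t }.

Lemma moment_cvg m F f r : bounded_cvg F f -> 0 <= r <= 1 ->
  moment m (F k) r @[k --> \oo] --> moment m f r.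
Proof.
move=> [cF cf [b Fb] Ff] /andP[r0 r1].
have fin (g : R -> R) : continuous g ->
    (\int[mu]_(t in `[0%R, r]) (t ^+ m * g t)%R%:E)%E \is a fin_num.
  by move=> cg; apply: integrable_fin_num => //; exact: integrable_pow_mul.
apply: fine_cvg; rewrite fineK; last exact: fin.
have b0 : 0 <= b by apply: le_trans (Fb 0%N 0 _); rewrite ?lexx ?ler01.
apply: (@dominated_cvg _ _ _ mu `[0, r] _ (fun k t => (t ^+ m * F k t)%:E) _
  (fun t => (t ^+ 0 * b)%:E)) => //.
- move=> k; have /integrableP[] := @integrable_pow_mul _ m _ r (cF k) => //.
- move=> t /=; rewrite in_itv /= => /andP[t0 tr]; apply: cvg_EFin.
    by apply: nearW.
  apply: cvgMr; apply: Ff; rewrite t0 (le_trans tr) //.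
- by apply: (@integrable_pow_mul _ 0 (fun=> b) r) => x; exact: cvg_cst.
- move=> k t /=; rewrite in_itv /= => /andP[t0 tr]; have t1 := le_trans tr r1.
  rewrite lee_fin expr0 mul1r normrM -[leRHS]mul1r ler_pM //.
    by rewrite normrX ger0_norm // exprn_ile1.
  by apply: Fb; rewrite t0.
Qed.

Lemma bounded_cvg_moment m F f : bounded_cvg F f ->
  bounded_cvg (fun k => moment m (F k)) (moment m f).
Proof.
move=> h; have [cF cf [b Fb] Ff] := h; split.
- by move=> k; exact: continuous_moment.
- exact: continuous_moment.
- by exists b => k t ht; apply: moment_bound => //; exact: Fb.
- by move=> t; exact: moment_cvg.
Qed.

Lemma bounded_cvg_average m F f : bounded_cvg F f ->
  bounded_cvg (fun k => average m (F k)) (average m f).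
Proof.
move=> h; have [cF cf [b Fb] Ff] := h; split.
- by move=> k; exact: continuous_average.
- exact: continuous_average.
- by exists b => k t ht; apply: average_bound => //; exact: Fb.
- move=> t t01; rewrite /average; case: ifP => t0; apply: cvgMl.
    exact: moment_cvg.
  by apply: Ff; rewrite lexx ler01.
Qed.

Lemma bounded_cvg_sub_const F f (C : nat -> R) c : bounded_cvg F f ->
  C k @[k --> \oo] --> c ->
  bounded_cvg (fun k t => F k t - C k) (fun t => f t - c).
Proof.
move=> [cF cf [b Fb] Ff] Cc; split.
- by move=> k t; apply: cvgB; [exact: cF|exact: cvg_cst].
- by move=> t; apply: cvgB; [exact: cf|exact: cvg_cst].
- have [M [_ hM]] := cvg_seq_bounded (cvgP _ Cc).
  exists (b + (M + 1)) => k t /(Fb k) h.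
  rewrite (le_trans (ler_normB _ _)) // lerD // hM // ltrDl //.
- by move=> t t01; apply: cvgB => //; exact: Ff.
Qed.

End BoundedConvergence.

(** * The radial Dirichlet problem for the bilaplacian *)

Section GreenOperator.
Context {R : realType}.
Implicit Types (f g : R -> R) (n : nat) (c r rho : R).

(** The inverse of the radial Laplacian in dimension [n + 1] that vanishes at
    the origin: its derivative [r * average n f r] has flux [moment n f r]. *)
Definition radial_primitive n f : R -> R := moment 1 (average n f).

Lemma continuous_radial_primitive n f : continuous f ->
  continuous (radial_primitive n f).
Proof. by move=> cf; exact/continuous_moment/continuous_average. Qed.

Lemma is_derive_radial_primitive n f r : continuous f -> 0 < r ->
  is_derive r 1 (radial_primitive n f) (r * average n f r).
Proof.
by move=> cf r0; apply: (is_derive_moment 1); first exact: continuous_average.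
Qed.

(** The constant is the one that makes the flux of the solution vanish on the
    unit sphere, that is, its normal derivative (average_green_laplacian1). *)
Definition green_laplacian n f r : R :=
  radial_primitive n f r - n.+1%:R * average n (radial_primitive n f) 1.

Definition green n f r : R :=
  radial_primitive n (green_laplacian n f) r -
  radial_primitive n (green_laplacian n f) 1.

Definition green_deriv n f r : R := r * average n (green_laplacian n f) r.

Lemma continuous_green_laplacian n f : continuous f ->
  continuous (green_laplacian n f).
Proof.
move=> cf t; apply: cvgB; [exact: continuous_radial_primitive|exact: cvg_cst].
Qed.

Lemma continuous_green n f : continuous f -> continuous (green n f).
Proof.
move=> cf t; apply: cvgB; last exact: cvg_cst.
exact/continuous_radial_primitive/continuous_green_laplacian.
Qed.

Lemma is_derive_sub_const g dg c r : is_derive r 1 g dg ->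
  is_derive r 1 (fun t => g t - c) dg.
Proof.
by move=> h; rewrite -[dg]subr0; exact: is_derive_sub (is_derive_const c r).
Qed.

Lemma is_derive_green_laplacian n f r : continuous f -> 0 < r ->
  is_derive r 1 (green_laplacian n f) (r * average n f r).
Proof.
by move=> cf r0; exact/is_derive_sub_const/is_derive_radial_primitive.
Qed.

Lemma is_derive_green n f r : continuous f -> 0 < r ->
  is_derive r 1 (green n f) (green_deriv n f r).
Proof.
move=> cf r0; apply/is_derive_sub_const/is_derive_radial_primitive => //.
exact: continuous_green_laplacian.
Qed.

Lemma green1 n f : green n f 1 = 0.
Proof. by rewrite /green subrr. Qed.

(** Both sides times [r ^ n.+1] have the same derivative and vanish at [0]. *)
Lemma average_sub_const n g c r : continuous g -> 0 < r ->
  average n (fun t => g t - c) r = average n g r - c / n.+1%:R.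
Proof.
move=> cg r0.
have cgc : continuous (fun t => g t - c).
  by move=> t; apply: cvgB; [exact: cg|exact: cvg_cst].
pose F t := moment n (fun t => g t - c) t - moment n g t + c * (t ^+ n.+1 / n.+1%:R).
have : F 0 = F r.
  apply: eq_of_derive_eq0; first exact: ltW.
    apply: continuous_subspaceT => t.
    apply: cvgD; first by apply: cvgB; exact: continuous_moment.
    apply: cvgMr; apply: cvgMl; exact: exprn_continuous.
  move=> t /andP[t0 tr].
  apply: (is_derive_eq (is_derive_add (is_derive_sub
    (is_derive_moment n cgc t0) (is_derive_moment n cg t0))
    (is_derive_scale c (is_derive_pow_div n t)))).
  by ring.
rewrite /F !(@moment_le0 _ _ _ 0) // expr0n /= mul0r mulr0 subrr addr0.
rewrite !averageE // => e.
have rn : r ^+ n.+1 != 0 by rewrite expf_neq0 // gt_eqF.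
apply: (mulIf rn); rewrite mulrBl !divfK //.
have -> : c / n.+1%:R * r ^+ n.+1 = c * (r ^+ n.+1 / n.+1%:R) by rewrite mulrAC mulrA.
by rewrite -[LHS]subr0 [X in _ - X]e opprD opprB addrA addrCA subrr addr0.
Qed.

Lemma average_green_laplacian1 n f : continuous f ->
  average n (green_laplacian n f) 1 = 0.
Proof.
move=> cf; rewrite average_sub_const //; last exact: continuous_radial_primitive.
by rewrite mulrAC divff // mul1r subrr.
Qed.

Lemma cvg_green1 n f : continuous f -> green n f t @[t --> 1^'-] --> (0 : R).
Proof.
move=> cf; rewrite -[X in _ --> X](green1 n f).
by apply: cvg_at_left_filter; exact: continuous_green.
Qed.

Lemma continuous_green_deriv n f : continuous f -> continuous (green_deriv n f).
Proof.
move=> cf t; apply: (@continuousM R _ id); first exact: cvg_id.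
exact/continuous_average/continuous_green_laplacian.
Qed.

Lemma cvg_green_deriv1 n f : continuous f ->
  green_deriv n f t @[t --> 1^'-] --> (0 : R).
Proof.
move=> cf; have d1 : green_deriv n f 1 = 0.
  by rewrite /green_deriv average_green_laplacian1 ?mulr0.
rewrite -[X in _ --> X]d1; apply: cvg_at_left_filter; exact: continuous_green_deriv.
Qed.

Lemma polar_green n rho f : continuous f ->
  polar n rho (green n f) (green_deriv n f)
    (green_laplacian n f) (fun r => r * average n f r) f.
Proof.
have main g r : continuous g -> 0 < r ->
    is_derive r 1 (fun t => t ^+ n * (t * average n g t)) (r ^+ n * g r).
  move=> cg r0; have h := is_derive_moment n cg r0.
  apply: (near_eq_is_derive _ h); near=> t.
  have t0 : 0 < t by near: t; exact: lt_nbhsr.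
  by rewrite moment_average ?ltW // exprSr mulrA.
have lim0 g : continuous g -> t ^+ n * (t * average n g t) @[t --> 0^'+] --> (0 : R).
  move=> cg; apply: cvg_at_right_filter.
  have : t ^+ n * (t * average n g t) @[t --> 0] --> 0 ^+ n * (0 * average n g 0).
    apply: cvgM; first exact: exprn_continuous.
    by apply: cvgM; [exact: cvg_id|exact: continuous_average].
  by rewrite mul0r mulr0.
move=> cf; have ch := @continuous_green_laplacian n f cf.
split.
- by move=> r /andP[r0 _]; exact: is_derive_green.
- by move=> r /andP[r0 _]; exact: main.
- by move=> r /andP[r0 _]; exact: is_derive_green_laplacian.
- by move=> r /andP[r0 _]; exact: main.
- exact: lim0.
- exact: lim0.
Unshelve. all: by end_near. Qed.

Lemma bounded_cvg_green n (F : nat -> R -> R) f : bounded_cvg F f ->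
  bounded_cvg (fun k => green n (F k)) (green n f).
Proof.
have prim G g : bounded_cvg G g ->
    bounded_cvg (fun k => radial_primitive n (G k)) (radial_primitive n g).
  by move=> h; exact/bounded_cvg_moment/bounded_cvg_average.
have at1 G g : bounded_cvg G g -> G k 1 @[k --> \oo] --> g 1.
  by case=> _ _ _; apply; rewrite ler01 lexx.
move=> h.
have hl : bounded_cvg (fun k => green_laplacian n (F k)) (green_laplacian n f).
  apply: bounded_cvg_sub_const; first exact: prim.
  by apply: cvgMr; exact: at1 (bounded_cvg_average n (prim _ _ h)).
by apply: bounded_cvg_sub_const; [exact: prim|exact: at1 (prim _ _ hl)].
Qed.

End GreenOperator.

Lemma continuous_big_sum (R : realType) (T : topologicalType) (I : Type)
    (s : seq I) (F : I -> T -> R) (x : T) :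
  (forall i, {for x, continuous (F i)}) ->
  {for x, continuous (fun y => \sum_(i <- s) F i y)}.
Proof.
move=> Fc; elim: s => [|i s IH].
  rewrite (_ : (fun _ => _) = fun=> 0); first exact: cvg_cst.
  by apply/funext => y; rewrite big_nil.
rewrite (_ : (fun _ => _) = (fun y => F i y + \sum_(j <- s) F j y)).
  by apply: cvgD; [exact: Fc|exact: IH].
by apply/funext => y; rewrite big_cons.
Qed.

(** * The Euclidean norm and directional derivatives *)

Section EuclideanNorm.
Context {R : realType} {N : nat}.
Implicit Types (x y v : 'rV[R]_N) (f g : 'rV[R]_N -> R) (i j : 'I_N) (h c : R).

Lemma enorm_ge0 x : 0 <= enorm x. Proof. exact: sqrtr_ge0. Qed.

Lemma sqr_enorm x : enorm x ^+ 2 = \sum_(i < N) x ord0 i ^+ 2.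
Proof. by rewrite sqr_sqrtr // sumr_ge0 // => i _; exact: sqr_ge0. Qed.

Lemma enorm_eq0 x : enorm x = 0 -> x = 0.
Proof.
move=> x0; have := sqr_enorm x; rewrite x0 expr0n /= => /esym/eqP.
rewrite psumr_eq0 => [/allP h|i _]; last exact: sqr_ge0.
apply/rowP => i; rewrite mxE; apply/eqP; rewrite -sqrf_eq0.
by apply: h; rewrite mem_index_enum.
Qed.

Lemma enorm0 : enorm (0 : 'rV[R]_N) = 0.
Proof. by rewrite /enorm big1 ?sqrtr0 // => i _; rewrite mxE expr0n. Qed.

Lemma enormZ c x : enorm (c *: x) = `|c| * enorm x.
Proof.
rewrite /enorm -sqrtr_sqr -sqrtrM ?sqr_ge0 //; congr Num.sqrt.
by rewrite mulr_sumr; apply: eq_bigr => i _; rewrite mxE exprMn.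
Qed.

Lemma enorm_basis i : enorm (basis_vec i : 'rV[R]_N) = 1.
Proof.
rewrite /enorm (bigD1 i) //= big1 ?addr0 => [|j ji]; rewrite /basis_vec mxE ?eqxx.
  by rewrite expr1n sqrtr1.
by rewrite (negbTE ji) andbF expr0n.
Qed.

Lemma continuous_enorm : continuous (@enorm R N).
Proof.
move=> x; apply: (@continuous_comp _ _ _ (fun x : 'rV[R]_N => \sum_(i < N) x ord0 i ^+ 2)
  Num.sqrt); last exact: sqrt_continuous.
apply: continuous_big_sum => i.
apply: (@continuous_comp _ _ _ (fun x : 'rV[R]_N => x ord0 i) (fun t => t ^+ 2)).
  exact: coord_continuous.
exact: exprn_continuous.
Qed.

Lemma open_unit_ball : open (@unit_ball R N).
Proof.
rewrite (_ : unit_ball = (@enorm R N) @^-1` [set r | r < 1]) //.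
by apply: open_comp; [move=> x _; exact: continuous_enorm|exact: open_lt].
Qed.

Lemma is_derive_along f y v (t d : R) :
  is_derive (t *: v + y) v f d <-> is_derive t 1 (fun s : R => f (s *: v + y)) d.
Proof.
have E : (fun h : R => h^-1 *: ((f \o shift (t *: v + y)) (h *: v) - f (t *: v + y))) =
    (fun h : R => h^-1 *: (((fun s : R => f (s *: v + y)) \o shift t) (h *: 1)
      - f (t *: v + y))).
  by apply/funext => h /=; rewrite addrA -scalerDl [_%:A]mulr1.
split=> -[d1 d2].
  by apply: DeriveDef; [move: d1; rewrite /derivable E|rewrite -d2 /derive E].
by apply: DeriveDef; [rewrite /derivable E|rewrite -d2 /derive E].
Qed.

Lemma is_derive_line f x v (d : R) :
  is_derive x v f d <-> is_derive (0 : R) 1 (fun h : R => f (h *: v + x)) d.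
Proof. by rewrite -is_derive_along scale0r add0r. Qed.

Lemma is_derive_coord x i j :
  is_derive x (basis_vec i) (fun y => y ord0 j) (i == j)%:R.
Proof.
apply/is_derive_line.
rewrite (_ : (fun h : R => _) = (fun h => h * (i == j)%:R + x ord0 j)); last first.
  by apply/funext => h; rewrite !mxE eqxx /= [j == i]eq_sym.
have h1 : is_derive (0 : R) 1 (fun h : R => h * (i == j)%:R) (i == j)%:R.
  have := is_derive_mul (@is_derive_id R R 0 1) (is_derive_const (i == j)%:R (0 : R)).
  by rewrite mul1r mul0r addr0.
by have := is_derive_add h1 (is_derive_const (x ord0 j) 0); rewrite addr0.
Qed.

Lemma sqr_enorm_line x i h :
  enorm (h *: basis_vec i + x) ^+ 2 = enorm x ^+ 2 + (2 * x ord0 i * h + h ^+ 2).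
Proof.
rewrite !sqr_enorm (bigD1 i) //= [in RHS](bigD1 i) //= [RHS]addrAC.
congr (_ + _).
  by rewrite !mxE !eqxx /=; ring.
apply: eq_bigr => j ji; rewrite !mxE (negbTE ji) andbF mulr0 add0r //.
Qed.

End EuclideanNorm.

(** * Functions with continuous partial derivatives *)

Section CkCalculus.
Context {R : realType} {N : nat} (U : set 'rV[R]_N) (oU : open U).
Implicit Types (x y v : 'rV[R]_N) (f g : 'rV[R]_N -> R) (i j : 'I_N) (k : nat).

Lemma near_open (P : 'rV[R]_N -> Prop) x : U x -> (forall y, U y -> P y) ->
  \forall y \near x, P y.
Proof.
move=> Ux UP; have : nbhs x U by apply: open_nbhs_nbhs.
by apply: filterS.
Qed.

Lemma partialE i f x d : is_derive x (basis_vec i) f d -> partial i f x = d.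
Proof. by move=> [_ <-]. Qed.

Lemma eq_on_partial i f g : (forall x, U x -> f x = g x) ->
  forall x, U x -> partial i f x = partial i g x.
Proof. by move=> fg x Ux; exact: near_eq_derive (near_open Ux fg). Qed.

Lemma eq_on_Ck k f g : (forall x, U x -> f x = g x) -> Ck_on k U f -> Ck_on k U g.
Proof.
elim: k f g => [|k IH] f g fg.
  move=> [cf _]; split => // x xU; have Ux : U x by rewrite inE in xU.
  have := cf x xU; rewrite /continuous_at -(fg x Ux); apply: cvg_trans.
  exact: near_eq_cvg (near_open Ux fg).
move=> [cf df]; split => [x xU|i].
  have Ux : U x by rewrite inE in xU.
  have := cf x xU; rewrite /continuous_at -(fg x Ux); apply: cvg_trans.
  exact: near_eq_cvg (near_open Ux fg).
have [di Ci] := df i; split.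
  by move=> x Ux; exact: near_eq_derivable (near_open Ux fg) (di x Ux).
by apply: IH Ci; exact: eq_on_partial.
Qed.

Lemma Ck_cont k f x : Ck_on k U f -> U x -> {for x, continuous f}.
Proof. by case: k => [|k] [cf _] Ux; apply: cf; rewrite inE. Qed.

Lemma Ck_is_derive k f x i : Ck_on k.+1 U f -> U x ->
  is_derive x (basis_vec i) f (partial i f x).
Proof. by move=> [_ /(_ i)[d _]] Ux; apply/derivableP/d. Qed.

Lemma Ck_partial k f i : Ck_on k.+1 U f -> Ck_on k U (partial i f).
Proof. by move=> [_ /(_ i)[]]. Qed.

Lemma Ck_pred k f : Ck_on k.+1 U f -> Ck_on k U f.
Proof.
elim: k f => [|k IH] f [cf df]; split => // i.
by have [di Ci] := df i; split => //; exact: IH.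
Qed.

Lemma Ck_first k f : Ck_on k.+1 U f -> Ck_on 1 U f.
Proof. by elim: k => [|k IH] // /Ck_pred. Qed.

(** Any family of functions that are the partial derivatives on [U] may be used:
    off [U] the operator [partial] need not agree with them. *)
Lemma Ck_intro k f (df : 'I_N -> 'rV[R]_N -> R) :
  (forall x, U x -> {for x, continuous f}) ->
  (forall i x, U x -> is_derive x (basis_vec i) f (df i x)) ->
  (forall i, Ck_on k U (df i)) -> Ck_on k.+1 U f.
Proof.
move=> cf fd Cdf; split=> [x|i]; first by rewrite inE; exact: cf.
split=> [x Ux|]; first by case: (fd i x Ux).
by apply: eq_on_Ck (Cdf i) => x Ux; rewrite (partialE (fd i x Ux)).
Qed.

Lemma Ck_cst k (c : R) : Ck_on k U (fun=> c).
Proof.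
elim: k c => [|k IH] c; first by split => // x _; exact: cst_continuous.
apply: (Ck_intro (df := fun _ _ => 0)) => //.
by move=> x _; exact: cst_continuous.
Qed.

Lemma CkD k f g : Ck_on k U f -> Ck_on k U g -> Ck_on k U (fun x => f x + g x).
Proof.
elim: k f g => [|k IH] f g Cf Cg.
  split => // x; rewrite inE => Ux.
  by exact: continuousD (Ck_cont Cf Ux) (Ck_cont Cg Ux).
apply: (Ck_intro (df := fun i x => partial i f x + partial i g x)).
- by move=> x Ux; exact: continuousD (Ck_cont Cf Ux) (Ck_cont Cg Ux).
- by move=> i x Ux; exact: is_derive_add (Ck_is_derive i Cf Ux) (Ck_is_derive i Cg Ux).
- by move=> i; exact: IH (Ck_partial i Cf) (Ck_partial i Cg).
Qed.

Lemma CkM k f g : Ck_on k U f -> Ck_on k U g -> Ck_on k U (fun x => f x * g x).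
Proof.
elim: k f g => [|k IH] f g Cf Cg.
  split => // x; rewrite inE => Ux.
  by exact: continuousM (Ck_cont Cf Ux) (Ck_cont Cg Ux).
apply: (Ck_intro (df := fun i x => partial i f x * g x + f x * partial i g x)).
- by move=> x Ux; exact: continuousM (Ck_cont Cf Ux) (Ck_cont Cg Ux).
- by move=> i x Ux; exact: is_derive_mul (Ck_is_derive i Cf Ux) (Ck_is_derive i Cg Ux).
- by move=> i; exact: CkD (IH _ _ (Ck_partial i Cf) (Ck_pred Cg))
    (IH _ _ (Ck_pred Cf) (Ck_partial i Cg)).
Qed.

Lemma Ck_sum k (I : Type) (s : seq I) (F : I -> 'rV[R]_N -> R) :
  (forall a : I, Ck_on k U (F a)) -> Ck_on k U (fun x => \sum_(a <- s) F a x).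
Proof.
move=> CF; elim: s => [|a s IH].
  by apply: eq_on_Ck (Ck_cst k 0) => x _; rewrite big_nil.
by apply: eq_on_Ck (CkD (CF a) IH) => x _; rewrite big_cons.
Qed.

Lemma Ck_coord k i : Ck_on k U (fun x => x ord0 i).
Proof.
case: k => [|k]; first by split => // x _; exact: coord_continuous.
apply: (Ck_intro (df := fun j _ => (j == i)%:R)).
- by move=> x _; exact: coord_continuous.
- by move=> j x _; exact: is_derive_coord.
- by move=> j; exact: Ck_cst.
Qed.

End CkCalculus.

(** * Smooth radial functions *)

Section RadialFunctions.
Context {R : realType}.
Implicit Types (phi psi chi : R -> R) (r c h : R) (k : nat).

(** With [s = r ^ 2], the operator [phi' / r] is [2 * d / d s]; so this says that
    [phi] is [k] times continuously differentiable as a function of [r ^ 2] on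
    the closed unit interval, the condition under which [phi (enorm x)] is
    smooth at the origin as well. *)
Fixpoint radial_smooth k phi : Prop :=
  continuous phi /\
  if k is k'.+1 then
    exists psi, radial_smooth k' psi /\
      forall r, 0 < r < 1 -> is_derive r 1 phi (r * psi r)
  else True.

Lemma radial_smooth_cont k phi : radial_smooth k phi -> continuous phi.
Proof. by case: k => [|k] []. Qed.

(** By the mean value theorem the difference quotient at [h] is bounded by [h]
    times a bound of [psi] near the origin. *)
Lemma is_derive_radial0 phi psi : continuous phi -> continuous psi ->
  (forall r, 0 < r < 1 -> is_derive r 1 phi (r * psi r)) ->
  is_derive (0 : R) 1 (fun h => phi `|h|) 0.
Proof.
move=> cphi cpsi dphi.
suff lim : h^-1 * (phi `|h| - phi 0) @[h --> 0^'] --> (0 : R).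
  have E : (fun h : R => h^-1 *: (((fun h => phi `|h|) \o shift 0) (h *: 1) - phi `|0 : R|))
      = (fun h => h^-1 * (phi `|h| - phi 0)).
    by apply/funext => h; rewrite /= addr0 normr0 /GRing.scale /= mulr1.
  apply: DeriveDef; first by apply/cvg_ex; exists 0; rewrite E.
  by rewrite /derive E; exact/cvg_lim.
have [d /= d0 hd] : \forall t \near 0, `|psi 0 - psi t| < 1.
  by have /cvgrPdist_lt /(_ _ ltr01) := cpsi 0.
pose M := `|psi 0| + 1.
have M0 : 0 < M by rewrite ltr_wpDl.
apply/cvgrPdist_lt => e e0; near=> h.
have h0 : h != 0 by near: h; exact: nbhs_dnbhs_neq.
have h1 : `|h| < 1 by near: h; apply: dnbhs0_lt.
have hdd : `|h| < d by near: h; apply: dnbhs0_lt.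
have hM : `|h| < e / M by near: h; apply: dnbhs0_lt; rewrite divr_gt0.
have nh0 : 0 < `|h| by rewrite normr_gt0.
have dphi' r : r \in `]0, `|h|[ -> is_derive r 1 phi (r * psi r).
  by rewrite in_itv /= => /andP[r0 rh]; apply: dphi; rewrite r0 (lt_trans rh).
have [c] := MVT nh0 dphi' (continuous_subspaceT cphi).
rewrite in_itv /= => /andP[c0 ch]; rewrite subr0 => E.
rewrite sub0r normrN E.
rewrite !normrM normfV normr_id mulrCA mulVf ?gt_eqF // mulr1 gtr0_norm //.
have psic : `|psi c| <= M.
  have := hd c; rewrite /ball_ /= sub0r normrN gtr0_norm // => /(_ (lt_trans ch hdd)).
  move=> hh; rewrite -[psi c](subKr (psi 0)) (le_trans (ler_normB _ _)) //.
  by rewrite lerD2l ltW.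
apply: (@le_lt_trans _ _ (`|h| * M)); last by rewrite -ltr_pdivlMr.
by rewrite ler_pM // ltW.
Unshelve. all: by end_near. Qed.

End RadialFunctions.

Section RadialFields.
Context {R : realType} {N : nat}.
Implicit Types (phi psi chi : R -> R) (r c h : R) (k : nat)
  (x : 'rV[R]_N) (i : 'I_N).

(** Away from the origin this is the chain rule through
    [enorm x = sqrt (sum of squares)]; the origin is is_derive_radial0. *)
Lemma is_derive_radial phi psi x i : continuous phi -> continuous psi ->
  (forall r, 0 < r < 1 -> is_derive r 1 phi (r * psi r)) -> unit_ball x ->
  is_derive x (basis_vec i) (fun y => phi (enorm y)) (x ord0 i * psi (enorm x)).
Proof.
move=> cphi cpsi dphi xB; apply/is_derive_line.
have [x0|xn0] := eqVneq (enorm x) 0.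
  have -> := enorm_eq0 x0; rewrite mxE mul0r.
  rewrite (_ : (fun h : R => _) = (fun h => phi `|h|)); first exact: is_derive_radial0 dphi.
  by apply/funext => h; rewrite addr0 enormZ enorm_basis mulr1.
have x0 : 0 < enorm x by rewrite lt_def xn0 enorm_ge0.
pose q h := enorm x ^+ 2 + (2 * x ord0 i * h + h ^+ 2).
rewrite (_ : (fun h : R => _) = phi \o (Num.sqrt \o q)); last first.
  apply/funext => h /=; rewrite -[enorm _]ger0_norm ?enorm_ge0 //.
  by rewrite -sqrtr_sqr sqr_enorm_line.
have q0 : q 0 = enorm x ^+ 2 by rewrite /q mulr0 expr0n /= !addr0.
have sq0 : Num.sqrt (q 0) = enorm x by rewrite q0 sqrtr_sqr ger0_norm // ltW.
have qd : is_derive (0 : R) 1 q (2 * x ord0 i).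
  have h1 := is_derive_scale (2 * x ord0 i) (@is_derive_id R R 0 1).
  apply: (is_derive_eq (is_derive_add (is_derive_const (enorm x ^+ 2) 0)
    (is_derive_add h1 (is_derive_pow 2 0)))).
  by rewrite mulr1 mulr0 addr0 add0r.
have sd : is_derive (q 0) 1 Num.sqrt (2 * Num.sqrt (q 0))^-1.
  have q00 : 0 < q 0 by rewrite q0 exprn_gt0.
  by apply: (@is_derive1_sqrt _ (q 0)).
have pd : is_derive ((Num.sqrt \o q) 0) 1 phi (enorm x * psi (enorm x)).
  by rewrite /= sq0; apply: dphi; rewrite x0.
have := is_derive1_comp pd (is_derive1_comp sd qd).
move=> hh; apply: (is_derive_eq hh); rewrite sq0.
by field.
Qed.

(** The partial derivatives of [phi (enorm x)] are [x_i * psi (enorm x)] with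
    [psi] again smooth, so the induction closes. *)
Lemma radial_Ck k phi : radial_smooth k phi ->
  Ck_on k unit_ball (fun x : 'rV[R]_N => phi (enorm x)).
Proof.
have cont phi' : continuous phi' ->
    forall x, {for x, continuous (fun y : 'rV[R]_N => phi' (enorm y))}.
  by move=> c' x; apply: continuous_comp; [exact: continuous_enorm|exact: c'].
have oB := @open_unit_ball R N.
elim: k phi => [|k IH] phi; first by move=> [cphi _]; split => // x _; exact: cont.
move=> [cphi [psi [spsi dphi]]].
apply: (Ck_intro oB (df := fun i y => y ord0 i * psi (enorm y))).
- by move=> x _; exact: cont.
- by move=> i x xB; apply: is_derive_radial => //; exact: radial_smooth_cont spsi.
- by move=> i; have := CkM oB (Ck_coord oB k i) (IH psi spsi).
Qed.

Lemma radial_laplacian phi psi chi x :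
  continuous phi -> continuous psi -> continuous chi ->
  (forall r, 0 < r < 1 -> is_derive r 1 phi (r * psi r)) ->
  (forall r, 0 < r < 1 -> is_derive r 1 psi (r * chi r)) -> unit_ball x ->
  laplacian (fun y => phi (enorm y)) x =
  N%:R * psi (enorm x) + enorm x ^+ 2 * chi (enorm x).
Proof.
move=> cphi cpsi cchi dphi dpsi xB; have oB := @open_unit_ball R N.
rewrite /laplacian sqr_enorm mulr_suml -[in N%:R](card_ord N) -sumr_const mulr_suml.
rewrite -big_split /=; apply: eq_bigr => i _.
rewrite (eq_on_partial oB i _ xB (g := fun y => y ord0 i * psi (enorm y))); last first.
  by move=> y yB; apply: partialE; exact: is_derive_radial dphi yB.
apply: partialE.
have h := is_derive_mul (is_derive_coord x i i) (is_derive_radial i cpsi cchi dpsi xB).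
by apply: (is_derive_eq h); rewrite eqxx mulrA expr2.
Qed.

End RadialFields.

(** * Regularity of the Green operator *)

Section RadialSmoothCalculus.
Context {R : realType}.
Implicit Types (f g phi psi : R -> R) (r c : R) (k m n : nat).

(** Equations between profiles matter on the unit interval only; composing with
    this retraction extends them to the line continuously. *)
Definition clamp r : R := Num.max 0 (Num.min r 1).

Lemma continuous_clamp : continuous clamp.
Proof.
move=> r; apply: (@continuous_max R R (cst 0) (id \min cst 1)).
  exact: cst_continuous.
by apply: (@continuous_min R R id (cst 1)); [exact: cvg_id|exact: cst_continuous].
Qed.

Lemma clamp01 r : 0 <= clamp r <= 1.
Proof.
rewrite /clamp le_max lexx /= ge_max ler01 /= ge_min lexx orbT //.
Qed.

Lemma clamp_id r : 0 <= r <= 1 -> clamp r = r.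
Proof. by move=> /andP[r0 r1]; rewrite /clamp min_l // max_r. Qed.

Lemma radial_smooth_pred k phi : radial_smooth k.+1 phi -> radial_smooth k phi.
Proof.
elim: k phi => [|k IH] phi [c [psi [spsi d]]]; first by split.
by split => //; exists psi; split => //; exact: IH.
Qed.

Lemma radial_smooth_cst k c : radial_smooth k (fun=> c).
Proof.
elim: k c => [|k IH] c; split; [exact: cst_continuous|by []|exact: cst_continuous|].
by exists (fun=> 0); split => // r _; rewrite mulr0; exact: is_derive_const.
Qed.

Lemma radial_smoothD k f g : radial_smooth k f -> radial_smooth k g ->
  radial_smooth k (fun r => f r + g r).
Proof.
elim: k f g => [|k IH] f g.
  by move=> [cf _] [cg _]; split => // r; exact: continuousD (cf r) (cg r).
move=> [cf [f1 [sf df]]] [cg [g1 [sg dg]]]; split.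
  by move=> r; exact: continuousD (cf r) (cg r).
exists (fun r => f1 r + g1 r); split; first exact: IH.
by move=> r r01; rewrite mulrDr; apply: is_derive_add; [exact: df|exact: dg].
Qed.

Lemma radial_smoothM k f g : radial_smooth k f -> radial_smooth k g ->
  radial_smooth k (fun r => f r * g r).
Proof.
elim: k f g => [|k IH] f g.
  by move=> [cf _] [cg _]; split => // r; exact: continuousM (cf r) (cg r).
move=> Sf Sg; have [cf [f1 [sf df]]] := Sf; have [cg [g1 [sg dg]]] := Sg; split.
  by move=> r; exact: continuousM (cf r) (cg r).
exists (fun r => f1 r * g r + f r * g1 r); split.
  apply: radial_smoothD; apply: IH => //; exact: radial_smooth_pred.
move=> r r01; apply: (is_derive_eq (is_derive_mul (df r r01) (dg r r01))).
by ring.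
Qed.

Lemma radial_smoothV k f : (forall r, f r != 0) -> radial_smooth k f ->
  radial_smooth k (fun r => (f r)^-1).
Proof.
elim: k f => [|k IH] f f0.
  by move=> [cf _]; split => // r; apply: cvgV => //; exact: cf.
move=> Sf; have [cf [f1 [sf df]]] := Sf; split.
  by move=> r; apply: cvgV => //; exact: cf.
have sV := IH f f0 (radial_smooth_pred Sf).
exists (fun r => -1 * (f1 r * ((f r)^-1 * (f r)^-1))); split.
  by apply: radial_smoothM; [exact: radial_smooth_cst|do 2!apply: radial_smoothM => //].
move=> r r01; apply: (is_derive_eq (is_deriveV (f0 r) (df r r01))).
by rewrite /GRing.scale /=; field; exact: f0.
Qed.

Lemma radial_smooth_clamp k f : radial_smooth k f -> radial_smooth k (f \o clamp).
Proof.
have cc f' : continuous f' -> continuous (f' \o clamp).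
  by move=> cf r; apply: continuous_comp; [exact: continuous_clamp|exact: cf].
elim: k f => [|k IH] f; first by move=> [cf _]; split => //; exact: cc.
move=> [cf [f1 [sf df]]]; split; first exact: cc.
exists (f1 \o clamp); split; first exact: IH.
move=> r /andP[r0 r1]; rewrite /= clamp_id ?ltW //.
apply: near_eq_is_derive (df r _); last by rewrite r0.
near=> s; rewrite /= clamp_id //; apply/andP; split; apply: ltW; near: s.
  exact: lt_nbhsr.
exact: lt_nbhsl.
Unshelve. all: by end_near. Qed.

Lemma radial_smooth_average k m f : radial_smooth k f ->
  radial_smooth k (average m f).
Proof.
elim: k m f => [|k IH] m f; first by move=> [cf _]; split => //; exact: continuous_average.
move=> [cf [f1 [sf df]]]; split; first exact: continuous_average.
exists (average m.+2 f1); split; first exact: IH.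
by move=> r r01; exact: is_derive_average cf (radial_smooth_cont sf) df r01.
Qed.

Lemma radial_smooth_green_laplacian k n f : radial_smooth k f ->
  radial_smooth k.+1 (green_laplacian n f).
Proof.
move=> sf; have cf := radial_smooth_cont sf.
split; first exact: continuous_green_laplacian.
exists (average n f); split; first exact: radial_smooth_average.
by move=> r /andP[r0 _]; exact: is_derive_green_laplacian.
Qed.

(** The gain of two orders drives the bootstrap in green_classical_solution. *)
Lemma radial_smooth_green k n f : radial_smooth k f ->
  radial_smooth k.+2 (green n f).
Proof.
move=> sf; have cf := radial_smooth_cont sf.
split; first exact: continuous_green.
exists (average n (green_laplacian n f)); split.
  by apply: radial_smooth_average; exact: radial_smooth_green_laplacian.
by move=> r /andP[r0 _]; exact: is_derive_green.
Qed.

End RadialSmoothCalculus.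

Section GreenField.
Context {R : realType} {n : nat}.
Implicit Types (f : R -> R) (x : 'rV[R]_n.+1) (r : R).

(** In terms of averages the radial Laplacian of the primitive of [g] is the left
    side of the identity average_parts, whose right side is [g]. *)
Lemma laplacian_green f x : continuous f -> unit_ball x ->
  laplacian (fun y => green n f (enorm y)) x = green_laplacian n f (enorm x).
Proof.
move=> cf xB; have ch := @continuous_green_laplacian R n f cf.
have d2 r : 0 < r < 1 ->
    is_derive r 1 (green_laplacian n f) (r * average n f r).
  by move=> /andP[r0 _]; exact: is_derive_green_laplacian.
have ca := @continuous_average R n f cf.
have d1 r : 0 < r < 1 ->
    is_derive r 1 (green n f) (r * average n (green_laplacian n f) r).
  by move=> /andP[r0 _]; exact: is_derive_green.
have d3 r : 0 < r < 1 -> is_derive r 1 (average n (green_laplacian n f))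
    (r * average n.+2 (average n f) r).
  by move=> r01; exact: is_derive_average ch ca d2 r01.
have E := (radial_laplacian (continuous_green (n := n) cf)
  (continuous_average (m := n) ch) (continuous_average (m := n.+2) ca) d1 d3 xB); rewrite E.
by apply: (average_parts n ch ca d2); [exact: enorm_ge0|exact: ltW].
Qed.

Lemma bilaplacian_green f x : radial_smooth 1 f -> unit_ball x ->
  bilaplacian (fun y => green n f (enorm y)) x = f (enorm x).
Proof.
move=> [cf [f1 [[cf1 _] df]]] xB; have oB := @open_unit_ball R n.+1.
have -> : bilaplacian (fun y => green n f (enorm y)) x =
    laplacian (fun y => green_laplacian n f (enorm y)) x.
  rewrite /bilaplacian; apply: eq_bigr => i _.
  apply: (eq_on_partial oB i _ xB) => y yB.
  apply: (eq_on_partial oB i _ yB) => z zB.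
  exact: laplacian_green.
have ca := continuous_average (m := n) cf.
have d1 r : 0 < r < 1 ->
    is_derive r 1 (green_laplacian n f) (r * average n f r).
  by move=> /andP[r0 _]; exact: is_derive_green_laplacian.
have d2 r : 0 < r < 1 -> is_derive r 1 (average n f) (r * average n.+2 f1 r).
  by move=> r01; exact: is_derive_average cf cf1 df r01.
have E := (radial_laplacian (continuous_green_laplacian (n := n) cf) ca
  (continuous_average (m := n.+2) cf1) d1 d2 xB); rewrite E.
by apply: (average_parts n cf cf1 df); [exact: enorm_ge0|exact: ltW].
Qed.

(** The derivative of the profile at [1] vanishes by the choice of the constant
    in green_laplacian. *)
Lemma normal_derivative_green f x : continuous f -> unit_sphere x ->
  is_normal_derivative (fun y => green n f (enorm y)) x 0.
Proof.
move=> cf; rewrite /unit_sphere /= => x1.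
have [d e] := is_derive_green n cf (@ltr01 R).
rewrite /green_deriv average_green_laplacian1 // mulr0 in e.
have : h^-1 *: (green n f (h *: 1 + 1) - green n f 1) @[h --> 0^'] --> (0 : R).
  by rewrite -[X in _ --> X]e; exact: d.
move=> /cvg_dnbhs_at_left; apply: cvg_trans.
apply: near_eq_cvg; near=> h.
have h1 : -1 < h by near: h; apply: nbhs_left_gt; lra.
have -> : x + h *: x = (1 + h) *: x by rewrite scalerDl scale1r.
rewrite enormZ x1 mulr1 /GRing.scale /= mulr1 mulrC [1 + h]addrC ger0_norm //; lra.
Unshelve. all: by end_near. Qed.

(** A continuous fixed point is bootstrapped: [green n f] is twice smoother than
    [f], and [f] is a smooth function of [green n f] as this stays below [1]. *)
Lemma green_classical_solution (lambda : R) f : continuous f ->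
  (forall r, f r = lambda / (1 - green n f (clamp r)) ^+ 2) ->
  (forall r, 0 <= r < 1 -> 0 < green n f r < 1) ->
  classical_solution lambda (fun x : 'rV[R]_n.+1 => green n f (enorm x)).
Proof.
move=> cf fE w01; have oB := @open_unit_ball R n.+1.
have w1 r : 1 - green n f (clamp r) != 0.
  have /andP[] := clamp01 r; rewrite subr_eq0 eq_sym.
  rewrite [_ <= 1]le_eqVlt => c0 /orP[/eqP ->|c1].
    by rewrite green1 eq_sym oner_eq0.
  by have /andP[_ /lt_eqF ->] := w01 _ (introT andP (conj c0 c1)).
(* starting from [f] continuous, one turn of the bootstrap gives order two for
   [f], hence order four for [green n f] *)
have sf : radial_smooth 2 f.
  have sw : radial_smooth 2 (green n f \o clamp).
    by apply: radial_smooth_clamp; apply: radial_smooth_green; split.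
  have -> : f = fun r => lambda * (1 + -1 * (green n f \o clamp) r)^-1 *
      (1 + -1 * (green n f \o clamp) r)^-1.
    by apply/funext => r; rewrite fE /= mulN1r expr2 invfM mulrA.
  have sV : radial_smooth 2 (fun r => (1 + -1 * (green n f \o clamp) r)^-1).
    apply: radial_smoothV; first by move=> r; rewrite /= mulN1r.
    apply: radial_smoothD; first exact: radial_smooth_cst.
    by apply: radial_smoothM => //; exact: radial_smooth_cst.
  apply: radial_smoothM => //; apply: radial_smoothM => //.
  exact: radial_smooth_cst.
have Ck4 : Ck_on 4 unit_ball (fun x : 'rV[R]_n.+1 => green n f (enorm x)).
  exact/radial_Ck/radial_smooth_green.
have cw : continuous (fun x : 'rV[R]_n.+1 => green n f (enorm x)).
  move=> x; apply: continuous_comp; first exact: continuous_enorm.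
  exact: continuous_green.
have ca := continuous_average (m := n) (continuous_green_laplacian (n := n) cf).
split => //.
- split; first exact: continuous_subspaceT.
    by do 3!apply: Ck_pred.
  move=> i; exists (fun x => x ord0 i * average n (green_laplacian n f) (enorm x)).
    apply: continuous_subspaceT => x.
    apply: (@continuousM R _ (fun x => x ord0 i)
      (fun x => average n (green_laplacian n f) (enorm x))).
      exact: coord_continuous.
    by apply: continuous_comp; [exact: continuous_enorm|exact: ca].
  move=> x xB; apply: partialE; apply: is_derive_radial => //.
    exact: continuous_green.
  by move=> r /andP[r0 _]; exact: is_derive_green.
- move=> x xB; rewrite bilaplacian_green //; last exact: radial_smooth_pred.
  by rewrite {1}fE clamp_id // enorm_ge0 ltW.
- by move=> x xB; apply: w01; rewrite enorm_ge0.
- move=> x x1; split; first by rewrite /unit_sphere /= in x1; rewrite x1 green1.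
  exact: normal_derivative_green.
Qed.

End GreenField.

(** * Isometry invariance and radial symmetry *)

Section DirectionalDerivative.
Context {R : realType} {N : nat}.
Implicit Types (x y u v : 'rV[R]_N) (f A B : 'rV[R]_N -> R) (U : set 'rV[R]_N)
  (h t c : R).

Lemma MVT_symmetric (g dg : R -> R) h :
  (forall t, `|t| <= `|h| -> is_derive t 1 g (dg t)) ->
  exists2 c, `|c| <= `|h| & g h - g 0 = dg c * h.
Proof.
move=> gd.
have main a b : a <= b -> (forall t, a <= t <= b -> is_derive t 1 g (dg t)) ->
    exists2 c, a <= c <= b & g b - g a = dg c * (b - a).
  move=> ab gab; have [||c] := @MVT_segment R g dg a b ab.
  - by move=> t; rewrite in_itv /= => /andP[/ltW at_ /ltW tb]; apply: gab; rewrite at_.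
  - apply: continuous_in_subspaceT => t; rewrite inE /= in_itv /= => /gab.
    exact: is_derive_continuous.
  by rewrite in_itv /=; exists c.
have [h0|/ltW h0] := leP 0 h.
  have [|c /andP[c0 ch] e] := main 0 h h0.
    by move=> t /andP[t0 th]; apply: gd; rewrite !ger0_norm.
  by exists c; [rewrite !ger0_norm|rewrite e subr0].
have [|c /andP[ch c0] e] := main h 0 h0.
  by move=> t /andP[ht t0]; apply: gd; rewrite !ler0_norm // lerN2.
exists c; first by rewrite !ler0_norm // lerN2.
by rewrite -opprB e sub0r mulrN opprK.
Qed.

(** The increment along [h (u + v)] is split at [x + h u].  The part along [v]
    starts from a moving point, and the mean value theorem turns it into a value
    of [B] near [x]; this is where the continuity of [B] enters. *)
Lemma is_derive_dirD U f A B x u v : open U -> U x ->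
  (forall y, U y -> is_derive y u f (A y)) ->
  (forall y, U y -> is_derive y v f (B y)) -> {for x, continuous B} ->
  is_derive x (u + v) f (A x + B x).
Proof.
move=> oU Ux fu fv cB.
have E : (fun h : R => h^-1 *: ((f \o shift x) (h *: (u + v)) - f x)) =
  (fun h => h^-1 *: ((f \o shift x) (h *: u) - f x) +
    h^-1 * (f (h *: v + (h *: u + x)) - f (h *: u + x))).
  apply/funext => h; rewrite -[_ *: (_ - _)]/(h^-1 * _).
  rewrite -[X in _ = X + _]/(h^-1 * (f (h *: u + x) - f x)) -mulrDr.
  congr (_ * _); rewrite /=.
  have -> : h *: (u + v) + x = h *: v + (h *: u + x).
    by rewrite scalerDr addrA [h *: u + _]addrC.
  by rewrite [RHS]addrC [RHS]addrA subrK.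
have L1 : h^-1 *: ((f \o shift x) (h *: u) - f x) @[h --> 0^'] --> A x.
  by have [d <-] := fu x Ux; exact: d.
have L2 : h^-1 * (f (h *: v + (h *: u + x)) - f (h *: u + x)) @[h --> 0^'] --> B x.
  apply/cvgrPdist_lt => e e0.
  have : \forall y \near x, U y /\ `|B x - B y| < e.
    near=> y; split; near: y; first exact: open_nbhs_nbhs.
    by move/cvgrPdist_lt : cB => /(_ e e0).
  move=> /nbhs_ballP[r /= r0 hr].
  have K0 : 0 < `|u| + `|v| + 1 by rewrite ltr_wpDl ?addr_ge0.
  near=> h.
  have h0 : h != 0 by near: h; exact: nbhs_dnbhs_neq.
  have hK : `|h| < r / (`|u| + `|v| + 1).
    by near: h; apply: dnbhs0_lt; rewrite divr_gt0.
  have inb t : `|t| <= `|h| -> U (t *: v + (h *: u + x)) /\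
      `|B x - B (t *: v + (h *: u + x))| < e.
    move=> th; apply: hr; rewrite -ball_normE /ball_ /= addrA opprD addrCA subrr addr0 normrN.
    apply: le_lt_trans (ler_normD _ _) _; rewrite !normrZ.
    rewrite ltr_pdivlMr // in hK; apply: le_lt_trans hK.
    rewrite !mulrDr mulr1 addrC -addrA lerD2l -[leLHS]addr0 lerD // ler_wpM2r //.
  have [t th|c ch] := @MVT_symmetric (fun t => f (t *: v + (h *: u + x)))
    (fun t => B (t *: v + (h *: u + x))) h.
    by apply/is_derive_along/fv; have [] := inb t th.
  rewrite scale0r add0r => ->; rewrite mulrCA mulVf // mulr1.
  by have [] := inb c ch.
have L := cvgD L1 L2.
have L' : h^-1 *: ((f \o shift x) (h *: (u + v)) - f x) @[h --> 0^'] --> A x + B x.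
  by rewrite E; exact: L.
by apply: DeriveDef; [apply/cvg_ex; exists (A x + B x)|exact: cvg_lim L'].
Unshelve. all: by end_near. Qed.

Lemma is_derive_dirZ f x v c d : is_derive x v f d -> is_derive x (c *: v) f (c * d).
Proof.
move=> /is_derive_line h; apply/is_derive_line.
rewrite (_ : (fun h : R => _) = (fun s => f (s *: v + x)) \o (fun h => c * h)); last first.
  by apply/funext => s /=; rewrite scalerA mulrC.
have h1 : is_derive (0 : R) 1 (fun h : R => c * h) c.
  by apply: (is_derive_eq (is_derive_scale c (@is_derive_id R R 0 1))); rewrite mulr1.
rewrite [c * d]mulrC; apply: is_derive1_comp => //.
by rewrite mulr0.
Qed.

(** Only derivatives along the basis vectors are given; the others come from
    adding one basis direction at a time. *)
Lemma Ck_is_derive_dir U f x v : open U -> Ck_on 1 U f -> U x ->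
  is_derive x v f (\sum_(i < N) v ord0 i * partial i f x).
Proof.
move=> oU Cf Ux.
have vE : v = \sum_(i < N) v ord0 i *: basis_vec i.
  apply/rowP => j; rewrite summxE (bigD1 j) //= big1 ?addr0.
    by rewrite !mxE !eqxx mulr1.
  by move=> i ij; rewrite !mxE [j == i]eq_sym (negbTE ij) andbF mulr0.
rewrite [in X in is_derive x X]vE.
elim: (index_enum 'I_N) x Ux => [|i s IH] x Ux.
  by rewrite !big_nil; exact: is_derive0.
rewrite !big_cons addrC [X in is_derive _ _ _ X]addrC.
apply: (@is_derive_dirD U f (fun x => \sum_(j <- s) v ord0 j * partial j f x)
  (fun x => v ord0 i * partial i f x)) => //.
  move=> y Uy; apply: is_derive_dirZ; exact: Ck_is_derive Cf Uy.
apply: continuousM; first exact: cst_continuous.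
exact: Ck_cont (Ck_partial i Cf) Ux.
Qed.

End DirectionalDerivative.

Lemma continuous_mx (R : realType) (T : topologicalType) m n
    (F : T -> 'M[R]_(m, n)) : (forall i j, continuous (fun y => F y i j)) ->
  continuous F.
Proof.
move=> cF x A [P hP PA].
have : \forall y \near x, forall i j, P i j (F y i j).
  apply: filter_forall => i; apply: filter_forall => j.
  exact: (cF i j x _ (hP i j)).
by apply: filterS => y Py; exact: PA.
Qed.

Section Isometries.
Context {R : realType} {N : nat}.
Implicit Types (x y u v a : 'rV[R]_N) (f g : 'rV[R]_N -> R) (Q : 'M[R]_N) (k : nat).

Lemma sqr_enorm_mx x : enorm x ^+ 2 = (x *m x^T) 0 0.
Proof. by rewrite sqr_enorm mxE; apply: eq_bigr => i _; rewrite mxE expr2. Qed.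

Lemma enorm_isometry Q x : Q *m Q^T = 1%:M -> enorm (x *m Q) = enorm x.
Proof.
move=> QQ; apply/eqP; rewrite -(@eqrXn2 _ 2) ?enorm_ge0 //.
by rewrite !sqr_enorm_mx trmx_mul mulmxA -(mulmxA x) QQ mulmx1.
Qed.

Lemma continuous_mulmxr Q : continuous (fun x : 'rV[R]_N => x *m Q).
Proof.
apply: continuous_mx => i j x; under eq_fun do rewrite mxE.
apply: continuous_big_sum => k; apply: (@continuousM R _ (fun x : 'rV[R]_N => x i k)).
  by rewrite (ord1 i); exact: coord_continuous.
exact: cst_continuous.
Qed.

Lemma is_derive_mulmx f x v Q (d : R) : is_derive (x *m Q) (v *m Q) f d ->
  is_derive x v (fun y => f (y *m Q)) d.
Proof.
move=> /is_derive_line h; apply/is_derive_line.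
by under eq_fun do rewrite mulmxDl -scalemxAl.
Qed.

Lemma is_derive_basis_mulmx f x i Q : Q *m Q^T = 1%:M -> Ck_on 1 unit_ball f ->
  unit_ball x -> is_derive x (basis_vec i) (fun y => f (y *m Q))
    (\sum_(k < N) Q i k * partial k f (x *m Q)).
Proof.
move=> QQ Cf xB; apply: is_derive_mulmx.
have xQB : unit_ball (x *m Q) by rewrite /unit_ball /= enorm_isometry.
apply: (is_derive_eq (Ck_is_derive_dir _ open_unit_ball Cf xQB)).
by apply: eq_bigr => k _; rewrite -rowE mxE.
Qed.

Lemma Ck_isometry k f Q : Q *m Q^T = 1%:M -> Ck_on k unit_ball f ->
  Ck_on k unit_ball (fun x => f (x *m Q)).
Proof.
move=> QQ; have oB := @open_unit_ball R N.
have BQ x : unit_ball x -> unit_ball (x *m Q).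
  by rewrite /unit_ball /= enorm_isometry.
have cQ : continuous (fun x : 'rV[R]_N => x *m Q).
  exact: continuous_mulmxr.
have cf k' g : Ck_on k' unit_ball g -> forall x, unit_ball x ->
    {for x, continuous (fun x => g (x *m Q))}.
  move=> Cg x xB; apply: (@continuous_comp _ _ _ (fun x => x *m Q) g); first exact: cQ.
  exact: Ck_cont Cg (BQ x xB).
elim: k f => [|k IH] f Cf.
  by split => // x; rewrite inE => xB; exact: cf Cf x xB.
have C1 := Ck_first Cf.
apply: (Ck_intro oB (df := fun i x => \sum_(k < N) Q i k * partial k f (x *m Q))).
- by move=> x xB; exact: cf Cf x xB.
- by move=> i x xB; exact: is_derive_basis_mulmx.
- move=> i; apply: (Ck_sum oB) => j.
  exact: (CkM oB (Ck_cst oB k (Q i j)) (IH _ (Ck_partial j Cf))).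
Qed.

(** The second derivatives of [f] get contracted with [Q^T *m Q = 1]. *)
Lemma laplacian_isometry f Q x : Q *m Q^T = 1%:M -> Ck_on 2 unit_ball f ->
  unit_ball x -> laplacian (fun y => f (y *m Q)) x = laplacian f (x *m Q).
Proof.
move=> QQ Cf xB; have oB := @open_unit_ball R N.
have QtQ : Q^T *m Q = 1%:M by apply: mulmx1C.
have d2 i : partial i (partial i (fun y => f (y *m Q))) x =
    \sum_(k < N) Q i k * \sum_(l < N) Q i l * partial l (partial k f) (x *m Q).
  rewrite (eq_on_partial oB i _ xB (g := fun y => \sum_(k < N) Q i k * partial k f (y *m Q))).
    apply: partialE; apply: is_derive_big_sum => k.
    apply: is_derive_eq (is_derive_mul (is_derive_const (Q i k) x)
      (is_derive_basis_mulmx i QQ (Ck_partial k Cf) xB)) _.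
    by rewrite mul0r add0r.
  by move=> y yB; apply: partialE; apply: is_derive_basis_mulmx => //; exact: Ck_pred.
have -> : laplacian (fun y => f (y *m Q)) x = \sum_(i < N) \sum_(k < N)
    \sum_(l < N) Q i k * (Q i l * partial l (partial k f) (x *m Q)).
  by apply: eq_bigr => i _; rewrite d2; apply: eq_bigr => k _; rewrite mulr_sumr.
rewrite exchange_big /=; apply: eq_bigr => k _.
rewrite exchange_big /= (bigD1 k) //= [X in _ + X]big1 ?addr0 => [|l lk].
  under eq_bigr do rewrite mulrA; rewrite -mulr_suml.
  have -> : \sum_(i < N) Q i k * Q i k = (Q^T *m Q) k k.
    by rewrite mxE; apply: eq_bigr => i _; rewrite mxE.
  by rewrite QtQ mxE eqxx mul1r.
under eq_bigr do rewrite mulrA; rewrite -mulr_suml.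
have -> : \sum_(i < N) Q i k * Q i l = (Q^T *m Q) k l.
  by rewrite mxE; apply: eq_bigr => i _; rewrite mxE.
by rewrite QtQ mxE eq_sym (negbTE lk) mul0r.
Qed.

Lemma Ck_laplacian k f : Ck_on k.+2 unit_ball f -> Ck_on k unit_ball (laplacian f).
Proof.
move=> Cf; have oB := @open_unit_ball R N.
by apply: (Ck_sum oB) => i; do 2!apply: Ck_partial.
Qed.

Lemma bilaplacian_isometry f Q x : Q *m Q^T = 1%:M -> Ck_on 4 unit_ball f ->
  unit_ball x -> bilaplacian (fun y => f (y *m Q)) x = bilaplacian f (x *m Q).
Proof.
move=> QQ Cf xB; have oB := @open_unit_ball R N.
apply: etrans (laplacian_isometry QQ (Ck_laplacian Cf) xB).
apply: eq_bigr => i _; apply: (eq_on_partial oB i _ xB) => y yB.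
apply: (eq_on_partial oB i _ yB) => z zB.
by apply: laplacian_isometry => //; do 2!apply: Ck_pred.
Qed.

Lemma classical_solution_isometry (lambda : R) f Q : Q *m Q^T = 1%:M ->
  classical_solution lambda f -> classical_solution lambda (fun x => f (x *m Q)).
Proof.
move=> QQ [C4 [cf C1 ext] eqf f01 bd].
have eQ x : enorm (x *m Q) = enorm x by exact: enorm_isometry.
have BQ x : unit_ball x -> unit_ball (x *m Q) by rewrite /unit_ball /= eQ.
have cQ : continuous (fun x : 'rV[R]_N => x *m Q).
  exact: continuous_mulmxr.
have cont g : {within unit_cball, continuous g} ->
    {within unit_cball, continuous (fun x => g (x *m Q))}.
  move=> /subspace_continuousP cg; apply/subspace_continuousP => x xB.
  have xQB : unit_cball (x *m Q) by rewrite /unit_cball /= eQ.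
  apply: cvg_trans (cg _ xQB) => A /= hA.
  have := cQ x _ hA; rewrite /= !near_simpl; apply: filterS => y /= yA yB.
  by apply: yA; rewrite /unit_cball /= eQ.
split.
- exact: Ck_isometry.
- split; [exact: cont|exact: Ck_isometry|move=> i].
  have /choice[g hg] : forall k : 'I_N, exists g : 'rV[R]_N -> R,
      {within unit_cball, continuous g} /\
      forall x, unit_ball x -> partial k f x = g x.
    by move=> k; have [g g1 g2] := ext k; exists g.
  exists (fun x => \sum_(k < N) Q i k * g k (x *m Q)).
    move=> x; apply: (@continuous_big_sum R (subspace unit_cball)) => k.
    apply: (@continuousM R (subspace unit_cball)); first exact: cst_continuous.
    by have [+ _] := hg k; move/cont => /(_ x).
  move=> x xB; rewrite (partialE (is_derive_basis_mulmx i QQ C1 xB)).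
  by apply: eq_bigr => k _; have [_ ->] := hg k; last exact: BQ.
- move=> x xB; rewrite bilaplacian_isometry // eqf //; exact: BQ.
- by move=> x xB; apply: f01; exact: BQ.
- move=> x x1; have xQ1 : unit_sphere (x *m Q) by rewrite /unit_sphere /= eQ.
  have [b1 b2] := bd _ xQ1; split => //.
  rewrite /is_normal_derivative.
  by under eq_fun do rewrite mulmxDl -scalemxAl.
Qed.

(** The reflection in the hyperplane orthogonal to [x - y]. *)
Lemma householder x y : enorm x = enorm y -> x != y ->
  exists2 Q : 'M[R]_N, Q *m Q^T = 1%:M & x *m Q = y.
Proof.
move=> xy nxy; pose a := x - y; pose s := (a *m a^T) 0 0.
have s0 : s != 0.
  rewrite /s -sqr_enorm_mx sqrf_eq0; apply: contra nxy => /eqP/enorm_eq0 /eqP.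
  by rewrite subr_eq0.
have sE (b c : 'rV[R]_N) : b *m c^T = ((b *m c^T) 0 0)%:M.
  by apply/matrixP => i j; rewrite !ord1 [in RHS]mxE eqxx mulr1n.
have sym : x *m y^T = y *m x^T.
  by rewrite [LHS]sE [RHS]sE -[y *m x^T]trmxK trmx_mul trmxK [in RHS]mxE.
exists (1%:M - (2 / s) *: (a^T *m a)).
  have tr : (1%:M - (2 / s) *: (a^T *m a))^T = 1%:M - (2 / s) *: (a^T *m a).
    by rewrite linearB /= linearZ /= trmx1 trmx_mul trmxK.
  pose M := a^T *m a.
  have MM : M *m M = s *: M.
    rewrite /M -mulmxA [a *m (_ *m _)]mulmxA (sE a a) -/s mul_scalar_mx.
    by rewrite -scalemxAr.
  rewrite tr -/M mulmxBr mulmx1 mulmxBl mul1mx -scalemxAl -scalemxAr MM.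
  have cc : 2 / s * (2 / s) * s = 2 / s + 2 / s by field.
  rewrite !scalerA cc scalerDl; set V := _ *: M.
  have -> : V - (V + V) = - V by rewrite opprD addrA subrr sub0r.
  by rewrite opprK subrK.
have half : (2 / s) * (x *m a^T) 0 0 = 1.
  have sh : s = 2 * (x *m a^T) 0 0.
    have yy : y *m y^T = x *m x^T by rewrite [LHS]sE [RHS]sE -!sqr_enorm_mx xy.
    rewrite /s /a linearB /= mulmxBl !mulmxBr yy -sym.
    by move: (x *m x^T) (x *m y^T) => X Y; rewrite !mxE; ring.
  by rewrite mulrAC -sh divff.
rewrite mulmxBr mulmx1 -scalemxAr mulmxA (sE x a) mul_scalar_mx scalerA half.
by rewrite scale1r /a opprB addrCA subrr addr0.
Qed.

(** An orthogonal map carries [x] to [y] and [u] to another solution, which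
    minimality puts above [u]; exchanging [x] and [y] gives equality. *)
Lemma minimal_solution_radial (lambda : R) (u : 'rV[R]_N -> R) x y :
  minimal_solution lambda u -> unit_ball x -> enorm x = enorm y -> u x = u y.
Proof.
move=> [cu mu].
have le a b : unit_ball a -> enorm a = enorm b -> u a <= u b.
  move=> aB ab; have [->//|nab] := eqVneq a b.
  have [Q QQ <-] := householder ab nab.
  exact: (mu _ (classical_solution_isometry QQ cu)).
move=> xB xy; apply/eqP; rewrite eq_le !le //.
by rewrite /unit_ball /= -xy.
Qed.

End Isometries.

(** * The profile of a radial function along a ray *)

Section RadialProfile.
Context {R : realType} {n : nat}.
Implicit Types (f u : 'rV[R]_n.+1 -> R) (x y : 'rV[R]_n.+1) (r t h : R).

Definition axis : 'rV[R]_n.+1 := basis_vec ord0.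

Definition radial_on_ball f := forall x y, unit_ball x -> enorm x = enorm y -> f x = f y.

Lemma enorm_ray r : enorm (r *: axis) = `|r|.
Proof. by rewrite enormZ enorm_basis mulr1. Qed.

Lemma ray_in_ball r : 0 <= r < 1 -> unit_ball (r *: axis).
Proof. by move=> /andP[r0 r1]; rewrite /unit_ball /= enorm_ray ger0_norm. Qed.

Lemma radial_laplacian_on_ball f : Ck_on 2 unit_ball f -> radial_on_ball f ->
  radial_on_ball (laplacian f).
Proof.
move=> Cf rf x y xB xy; have oB := @open_unit_ball R n.+1.
have [->//|nxy] := eqVneq x y; have [Q QQ <-] := householder xy nxy.
rewrite -(laplacian_isometry QQ Cf xB); apply: eq_bigr => i _.
apply: (eq_on_partial oB i _ xB) => z zB; apply: (eq_on_partial oB i _ zB) => v vB.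
by apply: rf => //; rewrite enorm_isometry.
Qed.

Lemma is_derive_ray f r : Ck_on 1 unit_ball f -> 0 <= r < 1 ->
  is_derive r 1 (fun t => f (t *: axis)) (partial ord0 f (r *: axis)).
Proof.
move=> Cf r01.
have h : is_derive (r *: axis + 0) axis f (partial ord0 f (r *: axis)).
  by rewrite addr0; exact: Ck_is_derive Cf (ray_in_ball r01).
by move/is_derive_along: h; under eq_fun do rewrite addr0.
Qed.

(** Continuity of [K] at the single point [0] suffices, since the factor [t]
    vanishes there. *)
Lemma is_derive_id_mul (K : R -> R) : {for 0, continuous K} ->
  is_derive (0 : R) 1 (fun t => t * K t) (K 0).
Proof.
move=> cK.
have lim : h^-1 *: (((fun t : R => t * K t) \o shift (0 : R)) (h *: 1) - 0 * K 0)
    @[h --> 0^'] --> K 0.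
  have cK' : K h @[h --> 0^'] --> K 0 by apply: cvg_within_filter; exact: cK.
  apply: cvg_trans cK'; apply: near_eq_cvg; near=> h.
  have h0 : h != 0 by near: h; exact: nbhs_dnbhs_neq.
  by rewrite /= mul0r subr0 addr0 /GRing.scale /= mulr1 mulKf.
by apply: DeriveDef; [apply/cvg_ex; exists (K 0)|exact: cvg_lim lim].
Unshelve. all: by end_near. Qed.

(** Along a line orthogonal to the axis a radial function with profile [g] is
    [g (sqrt (r ^ 2 + t ^ 2))], whose derivative is [t] times a continuous
    function with value [g' r / r] at [t = 0]. *)
Lemma partial2_orthogonal f r (j : 'I_n.+1) : Ck_on 2 unit_ball f ->
  radial_on_ball f -> 0 < r < 1 -> j != ord0 ->
  partial j (partial j f) (r *: axis) = partial ord0 f (r *: axis) / r.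
Proof.
move=> Cf rf /andP[r0 r1] j0; have Cf1 := Ck_pred Cf.
pose s t := Num.sqrt (r ^+ 2 + t ^+ 2).
have s0 t : 0 < s t.
  by rewrite sqrtr_gt0 ltr_pwDl ?exprn_gt0 ?sqr_ge0.
have sE t : enorm (t *: basis_vec j + r *: axis) = s t.
  rewrite -[enorm _]ger0_norm ?enorm_ge0 // -sqrtr_sqr sqr_enorm_line enorm_ray.
  rewrite !mxE (negbTE j0) andbF !mulr0 mul0r add0r real_normK ?num_real //.
have sat0 : s 0 = r by rewrite /s expr0n addr0 sqrtr_sqr gtr0_norm.
have cs : continuous s.
  move=> t; apply: (@continuous_comp _ _ _ (fun t => r ^+ 2 + t ^+ 2) Num.sqrt).
    apply: (@continuousD R _ _ (fun=> r ^+ 2)); first exact: cst_continuous.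
    exact: exprn_continuous.
  exact: sqrt_continuous.
have near1 : \forall t \near (0 : R), s t < 1.
  have : \forall t \near 0, `|s 0 - s t| < 1 - r.
    by have /cvgrPdist_lt := cs 0; apply; rewrite subr_gt0.
  by apply: filterS => t; rewrite sat0 ltr_norml => /andP[h _]; lra.
pose P t := partial ord0 f (t *: axis).
have d1 t : s t < 1 ->
    partial j f (t *: basis_vec j + r *: axis) = t * (P (s t) / s t).
  move=> st1; have inB : unit_ball (t *: basis_vec j + r *: axis).
    by rewrite /unit_ball /= sE.
  have h1 := Ck_is_derive j Cf1 inB; move/is_derive_along: h1 => h1.
  have h2 : is_derive t 1 (fun t => f (s t *: axis)) (P (s t) * (t / s t)).
    have hs : is_derive t 1 s (t / s t).
      have q : is_derive t 1 (fun t => r ^+ 2 + t ^+ 2) (2 * t).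
        by apply: (is_derive_eq (is_derive_add (is_derive_const _ t)
          (is_derive_pow 2 t))); rewrite add0r.
      have sq : is_derive (r ^+ 2 + t ^+ 2) 1 Num.sqrt (2 * s t)^-1.
        by apply: is_derive1_sqrt; rewrite ltr_pwDl ?exprn_gt0 ?sqr_ge0.
      have := @is_derive1_comp R Num.sqrt (fun t => r ^+ 2 + t ^+ 2) t _ _ sq q.
      by move=> h; apply: (is_derive_eq h); field; rewrite gt_eqF.
    have hr := is_derive_ray Cf1 (introT andP (conj (ltW (s0 t)) st1)).
    exact: (@is_derive1_comp R (fun v => f (v *: axis)) s t _ _ hr hs).
  have h3 : is_derive t 1 (fun t => f (s t *: axis))
      (partial j f (t *: basis_vec j + r *: axis)).
    apply: near_eq_is_derive h1.
    have near1t : \forall v \near t, s v < 1.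
      have : \forall v \near t, `|s t - s v| < 1 - s t.
        by have /cvgrPdist_lt := cs t; apply; rewrite subr_gt0.
      by apply: filterS => v; rewrite ltr_norml => /andP[h _]; lra.
    apply: filterS near1t => v sv; apply: rf; first by rewrite /unit_ball /= sE.
    by rewrite sE enorm_ray gtr0_norm.
  by rewrite mulrCA; case: h2 => _ <-; case: h3 => _ <-.
apply: partialE; apply/is_derive_line.
have cK : {for 0, continuous (fun t => P (s t) / s t)}.
  apply: continuousM.
    apply: (@continuous_comp _ _ _ s P); first exact: cs.
    rewrite sat0; apply: (@continuous_comp _ _ _ (fun t : R => t *: axis) (partial ord0 f)).
      exact: scalel_continuous.
    by apply: Ck_cont (Ck_partial ord0 Cf) _; apply: ray_in_ball; rewrite ltW.
  by apply: cvgV; [rewrite sat0 gt_eqF|exact: cs].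
have := is_derive_id_mul cK; rewrite sat0 => h.
apply: near_eq_is_derive h; apply: filterS near1 => t st1.
by rewrite d1.
Unshelve. all: by end_near. Qed.

Lemma laplacian_ray f r : Ck_on 2 unit_ball f -> radial_on_ball f -> 0 < r < 1 ->
  laplacian f (r *: axis) = partial ord0 (partial ord0 f) (r *: axis) +
    n%:R * (partial ord0 f (r *: axis) / r).
Proof.
move=> Cf rf r01; rewrite /laplacian big_ord_recl; congr (_ + _).
rewrite (eq_bigr (fun=> partial ord0 f (r *: axis) / r)).
  by rewrite sumr_const card_ord mulr_natl.
by move=> i _; exact: partial2_orthogonal.
Qed.

(** This is [(r ^ n * w')' = r ^ n * (w'' + n * w' / r)], in which laplacian_ray
    recognizes the Laplacian. *)
Lemma is_derive_ray_flux f r : Ck_on 2 unit_ball f -> radial_on_ball f -> 0 < r < 1 ->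
  is_derive r 1 (fun t => t ^+ n * partial ord0 f (t *: axis))
    (r ^+ n * laplacian f (r *: axis)).
Proof.
move=> Cf rf /andP[r0 r1].
have h := is_derive_ray (Ck_partial ord0 Cf) (introT andP (conj (ltW r0) r1)).
apply: (is_derive_eq (is_derive_mul (is_derive_pow n r) h)).
rewrite laplacian_ray ?r0 // mulrDr addrC; congr (_ + _).
have -> m : m%:R * r ^+ m.-1 = r ^+ m * (m%:R / r).
  case: m => [|m]; first by rewrite !mul0r mulr0.
  by rewrite /= exprS; field; rewrite gt_eqF.
by rewrite -!mulrA [r^-1 * _]mulrC.
Qed.

Lemma cvg_ray0 f : (0 < n)%N -> Ck_on 0 unit_ball f ->
  t ^+ n * f (t *: axis) @[t --> 0^'+] --> (0 : R).
Proof.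
move=> n0 Cf; apply: cvg_at_right_filter.
have : t ^+ n * f (t *: axis) @[t --> 0] --> 0 ^+ n * f ((0 : R) *: axis).
  apply: cvgM; first exact: exprn_continuous.
  apply: (@continuous_comp _ _ _ (fun t : R => t *: axis) f).
    exact: scalel_continuous.
  by apply: (Ck_cont Cf); apply: ray_in_ball; rewrite lexx ltr01.
by rewrite expr0n gtn_eqF // mul0r.
Qed.

Lemma polar_ray u : (0 < n)%N -> Ck_on 4 unit_ball u -> radial_on_ball u ->
  polar n 1 (fun r => u (r *: axis)) (fun r => partial ord0 u (r *: axis))
    (fun r => laplacian u (r *: axis))
    (fun r => partial ord0 (laplacian u) (r *: axis))
    (fun r => bilaplacian u (r *: axis)).
Proof.
move=> n0 Cu ru; have CL := Ck_laplacian Cu.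
have C2 : Ck_on 2 unit_ball u by do 2!apply: Ck_pred.
have rL := radial_laplacian_on_ball C2 ru.
split.
- by move=> r /andP[r0 r1]; apply: is_derive_ray (Ck_pred C2) _; rewrite ltW.
- by move=> r; exact: is_derive_ray_flux.
- by move=> r /andP[r0 r1]; apply: is_derive_ray (Ck_pred CL) _; rewrite ltW.
- by move=> r; exact: is_derive_ray_flux.
- by apply: cvg_ray0 => //; apply: Ck_partial; apply: Ck_pred C2.
- by apply: cvg_ray0 => //; apply: Ck_partial; apply: Ck_pred CL.
Qed.

Lemma cvg_ray1 f : {within unit_cball, continuous f} ->
  f (t *: axis) @[t --> 1^'-] --> f axis.
Proof.
move=> /subspace_continuousP cf.
have aC : unit_cball axis by rewrite /unit_cball /= enorm_basis.
have cs : t *: axis @[t --> (1 : R)] --> axis.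
  by have := @scalel_continuous _ _ axis (1 : R); rewrite /continuous_at scale1r.
apply: cvg_trans (cf _ aC) => A /= hA.
have /= := cs _ hA; rewrite !near_simpl near_withinE.
apply: filter_app; near=> t; move=> h t1; apply: h.
rewrite /unit_cball /= enorm_ray ger0_norm ?ltW //.
by near: t; exact: lt_nbhsr.
Unshelve. all: by end_near. Qed.

(** The boundary condition concerns difference quotients of [u] at the sphere,
    whereas comparison needs the limit of the derivative inside the ball.  That
    limit exists by regularity up to the boundary, and the mean value theorem
    identifies it with the limit of the quotients. *)
Lemma ray_boundary lambda u : classical_solution lambda u ->
  u (t *: axis) @[t --> 1^'-] --> (0 : R) /\
  partial ord0 u (t *: axis) @[t --> 1^'-] --> (0 : R).
Proof.
move=> [C4 [cu C1 ext] _ _ bd].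
have a1 : unit_sphere axis by rewrite /unit_sphere /= enorm_basis.
have [ua0 nd] := bd _ a1.
have g1 := cvg_ray1 cu; rewrite ua0 in g1; split => //.
have [G cG GE] := ext ord0.
have p1 : partial ord0 u (t *: axis) @[t --> 1^'-] --> G axis.
  apply: cvg_trans (cvg_ray1 cG); apply: near_eq_cvg; near=> t; rewrite GE //.
  apply: ray_in_ball; apply/andP; split; last by near: t; exact: nbhs_left_lt.
  by near: t; exact: nbhs_left_ge.
suff <- : G axis = 0 by [].
apply: (@cvg_unique _ _ ((u (axis + h *: axis) - u axis) / h @[h --> 0^'-])) => //.
apply/cvgrPdist_lt => e e0.
have : \forall t \near 1^'-, `|G axis - partial ord0 u (t *: axis)| < e.
  by move/cvgrPdist_lt : p1; apply.
rewrite near_withinE => -[d /= d0 hd].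
near=> h.
have h0 : h < 0 by near: h; exact: nbhs_left_lt.
have hd' : - d < h by near: h; apply: nbhs_left_gt; rewrite oppr_lt0.
have h1 : -1 < h by near: h; apply: nbhs_left_gt; rewrite oppr_lt0.
have lt1 : 1 + h < 1 by lra.
have [||c] := @MVT R (fun t => u (t *: axis)) (fun t => partial ord0 u (t *: axis)) _ _ lt1.
- move=> t; rewrite in_itv /= => /andP[ht t1]; apply: is_derive_ray => //.
  by rewrite t1 andbT; lra.
- apply/(continuous_within_itvP _ lt1); split.
  + move=> t; rewrite in_itv /= => /andP[ht t1].
    apply: (is_derive_continuous (is_derive_ray C1 _)).
    by rewrite t1 andbT; lra.
  + apply: cvg_at_right_filter.
    apply: (is_derive_continuous (is_derive_ray C1 _)).
    by rewrite lt1 andbT; lra.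
  + by rewrite scale1r ua0.
rewrite in_itv /= => /andP[hc c1]; rewrite scale1r ua0 => E.
have -> : axis + h *: axis = (1 + h) *: axis by rewrite scalerDl scale1r.
have -> : (u ((1 + h) *: axis) - 0) / h = partial ord0 u (c *: axis).
  apply: (@mulIf _ h); first by rewrite lt_eqF.
  by rewrite divfK ?lt_eqF //; move: E; lra.
apply: hd => //; rewrite /ball_ /= ger0_norm; lra.
Unshelve. all: by end_near. Qed.

End RadialProfile.

(** * Picard iterates below a solution and below a barrier *)

Section PicardIteration.
Context {R : realType}.
Implicit Types (f g w v P H q : R -> R) (n k : nat) (r t lambda M rho : R).

Lemma le_on_closed_unit f c : continuous f ->
  (forall r, 0 < r < 1 -> f r <= c) -> forall r, 0 <= r <= 1 -> f r <= c.
Proof.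
move=> cf fc r /andP[]; rewrite le_eqVlt => /predU1P[<- _|r0].
  apply: (cvg_at_right_ge ltr01 _ fc); apply: cvg_at_right_filter; exact: cf.
rewrite le_eqVlt => /predU1P[->|r1]; last by apply: fc; rewrite r0.
apply: (cvg_at_left_ge ltr01 _ fc); apply: cvg_at_left_filter; exact: cf.
Qed.

Lemma ge_on_closed_unit f c : continuous f ->
  (forall r, 0 < r < 1 -> c <= f r) -> forall r, 0 <= r <= 1 -> c <= f r.
Proof.
move=> cf fc r r01; rewrite -lerN2; apply: (@le_on_closed_unit (fun t => - f t)) r01.
  by move=> t; apply: cvgN; exact: cf.
by move=> t /fc; rewrite lerN2.
Qed.

Lemma continuous_at_left f (a : R) : continuous f -> f t @[t --> a^'-] --> f a.
Proof. by move=> cf; apply: cvg_at_left_filter; exact: cf. Qed.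

Definition reaction lambda w r : R := lambda / (1 - w (clamp r)) ^+ 2.

Lemma reaction_le lambda (a b : R) : 0 < lambda -> a <= b -> b < 1 ->
  lambda / (1 - a) ^+ 2 <= lambda / (1 - b) ^+ 2.
Proof.
move=> l0 ab b1; rewrite ler_pM2l // lef_pV2 ?posrE ?exprn_gt0 ?subr_gt0 //.
  by rewrite lerXn2r ?nnegrE ?subr_ge0 ?(ltW b1) ?(le_trans ab (ltW b1)) // lerB.
exact: le_lt_trans b1.
Qed.

Lemma continuous_reaction lambda w : continuous (w \o clamp) ->
  (forall r, 0 <= r <= 1 -> w r < 1) -> continuous (reaction lambda w).
Proof.
move=> cw w1 r.
apply: (@continuousM R _ (fun=> lambda) (fun r => ((1 - w (clamp r)) ^+ 2)^-1)).
  exact: cst_continuous.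
apply: cvgV; first by rewrite expf_neq0 // gt_eqF // subr_gt0 w1 // clamp01.
apply: (@continuous_comp _ _ _ (fun t => 1 - (w \o clamp) t) (fun s => s ^+ 2)).
  by apply: continuousB; [exact: cst_continuous|exact: cw].
exact: exprn_continuous.
Qed.

Fixpoint picard n lambda k : R -> R :=
  if k is k'.+1 then green n (reaction lambda (picard n lambda k')) else fun=> 0.

Definition picard_deriv n lambda k r : R :=
  if k is k'.+1 then green_deriv n (reaction lambda (picard n lambda k')) r else 0.

(** What the iteration uses of the profile [g] of a solution: [P] is its
    derivative, and the bound [M], later required to be less than [1], keeps
    the reaction term bounded. *)
Record profile n lambda M g P H q : Prop := Profile {
  profile_polar : polar n 1 g P H q (fun r => lambda / (1 - g r) ^+ 2) ;
  profile_val1 : g t @[t --> 1^'-] --> (0 : R) ;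
  profile_der1 : P t @[t --> 1^'-] --> (0 : R) ;
  profile_le : forall r, 0 < r < 1 -> g r <= M }.

Lemma picard_polar n lambda k rho : continuous (reaction lambda (picard n lambda k)) ->
  polar n rho (picard n lambda k.+1) (picard_deriv n lambda k.+1)
    (green_laplacian n (reaction lambda (picard n lambda k)))
    (fun r => r * average n (reaction lambda (picard n lambda k)) r)
    (reaction lambda (picard n lambda k)).
Proof. exact: polar_green. Qed.

Section BelowProfile.
Context (n : nat) (lambda M : R) (g P H q : R -> R).
Context (l0 : 0 < lambda) (M0 : 0 <= M) (M1 : M < 1).
Context (g0 : forall r, 0 < r < 1 -> 0 <= g r).
Context (prof : profile n lambda M g P H q).

Lemma profile_deriv_le0 r : 0 < r < 1 -> P r <= 0.
Proof.
move=> r01; have [pol v1 d1 gM] := prof.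
have [] := polar_comparison pol _ v1 (lexx 0) d1 (lexx 0) r01 => //.
move=> t /gM gt; rewrite divr_ge0 ?(ltW l0) // exprn_ge0 // subr_ge0.
exact: le_trans gt (ltW M1).
Qed.

(** The reaction is increasing, so [w <= g] carries over to the source terms and
    the comparison principle gives the order of the solutions and the reverse
    order of their derivatives. *)
Lemma picard_step w : continuous w -> (forall r, 0 <= r <= 1 -> 0 <= w r <= M) ->
  (forall r, 0 < r < 1 -> w r <= g r) ->
  let f := reaction lambda w in
  [/\ continuous f,
    forall r, 0 < r < 1 -> P r <= green_deriv n f r /\ green n f r <= g r &
    forall r, 0 <= r <= 1 -> 0 <= green n f r <= M].
Proof.
move=> cw wM wg f; have [pol v1 d1 gM] := prof.
have cf : continuous f.
  apply: continuous_reaction.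
    by move=> r; apply: continuous_comp; [exact: continuous_clamp|exact: cw].
  by move=> r /wM /andP[_ h]; exact: le_lt_trans M1.
have cG := continuous_green (n := n) cf.
have polf := polar_green n 1 cf.
have vG := cvg_green1 n cf; have dG := cvg_green_deriv1 n cf.
have f0 t : 0 <= f t.
  by rewrite divr_ge0 ?(ltW l0) // exprn_ge0 // subr_ge0 (le_trans _ (ltW M1)) //;
    have /andP[] := wM _ (clamp01 t).
have cmp r : 0 < r < 1 -> P r <= green_deriv n f r /\ green n f r <= g r.
  move=> r01.
  have fle t : 0 < t < 1 -> f t <= lambda / (1 - g t) ^+ 2.
    move=> t01; rewrite /f /reaction clamp_id.
      apply: reaction_le => //; first exact: wg.
      exact: le_lt_trans (gM _ t01) M1.
    by case/andP: t01 => /ltW -> /ltW ->.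
  by have [] := polar_le polf pol fle vG v1 (lexx 0) dG d1 (lexx 0) r01.
split => // r r01; apply/andP; split.
  apply: ge_on_closed_unit r01 => // t t01.
  by have [] := polar_comparison polf _ vG (lexx 0) dG (lexx 0) t01.
apply: le_on_closed_unit r01 => // t t01.
by have [_ h] := cmp t t01; apply: le_trans h (gM t t01).
Qed.

Lemma picard_below k :
  [/\ continuous (picard n lambda k), continuous (reaction lambda (picard n lambda k)),
    forall r, 0 < r < 1 -> P r <= picard_deriv n lambda k r /\ picard n lambda k r <= g r &
    forall r, 0 <= r <= 1 -> 0 <= picard n lambda k r <= M].
Proof.
suff [cw wg wM] : [/\ continuous (picard n lambda k),
    forall r, 0 < r < 1 -> P r <= picard_deriv n lambda k r /\ picard n lambda k r <= g r &
    forall r, 0 <= r <= 1 -> 0 <= picard n lambda k r <= M].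
  have [cf _ _] := picard_step cw wM (fun r h => proj2 (wg r h)).
  by split.
elim: k => [|k [cw wg wM]].
  split; first by move=> r; exact: cst_continuous.
    by move=> r r01; split; [exact: profile_deriv_le0|exact: g0].
  by move=> r _; rewrite lexx.
have [cf cmp wM'] := picard_step cw wM (fun r h => proj2 (wg r h)).
by split => //; exact: continuous_green.
Qed.

Lemma picard_nondecreasing k r : 0 <= r <= 1 ->
  picard n lambda k r <= picard n lambda k.+1 r.
Proof.
move: r; elim: k => [|k IH] r r01.
  by have [_ _ _ /(_ _ r01)/andP[]] := picard_below 1.
have [cw cf _ wM] := picard_below k; have [cw' cf' _ wM'] := picard_below k.+1.
have [cw'' _ _ _] := picard_below k.+2.
rewrite -subr_ge0; apply: (@ge_on_closed_unit (fun t =>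
  picard n lambda k.+2 t - picard n lambda k.+1 t)) r01.
  by move=> t; apply: continuousB; [exact: cw''|exact: cw'].
move=> t t01.
rewrite subr_ge0.
have fle s : 0 < s < 1 -> reaction lambda (picard n lambda k) s <=
    reaction lambda (picard n lambda k.+1) s.
  move=> s01; have s01' : 0 <= s <= 1 by case/andP: s01 => /ltW -> /ltW ->.
  rewrite /reaction clamp_id //; apply: reaction_le => //; first exact: IH.
  by have /andP[_ h] := wM' _ s01'; exact: le_lt_trans M1.
by have [] := polar_le (picard_polar 1 cf) (picard_polar 1 cf') fle
  (cvg_green1 n cf) (cvg_green1 n cf') (lexx 0)
  (cvg_green_deriv1 n cf) (cvg_green_deriv1 n cf') (lexx 0) t01.
Qed.

(** The boundary data of [V] at [rho] dominate those of [g] and, by picard_below,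
    those of every iterate, value and slope alike.  So the comparison principle
    on the ball of radius [rho] carries the order through the induction, in
    which the source terms are ordered by hypothesis; comparing [V] with [g]
    itself would need the conclusion to order the source terms. *)
Lemma picard_le_barrier rho V pV HV qV fV (V1 pV1 g1 P1 : R) : 0 < rho <= 1 ->
  polar n rho V pV HV qV fV -> (forall r, 0 < r < rho -> 0 <= V r < 1) ->
  (forall r, 0 < r < rho -> lambda / (1 - V r) ^+ 2 <= fV r) ->
  V t @[t --> rho^'-] --> V1 -> pV t @[t --> rho^'-] --> pV1 ->
  g t @[t --> rho^'-] --> g1 -> P t @[t --> rho^'-] --> P1 ->
  g1 <= V1 -> pV1 <= P1 ->
  forall k r, 0 < r < rho -> picard n lambda k r <= V r.
Proof.
move=> /andP[rho0 rho1] polV V01 fV_ge vV vpV vg vP gV pP; elim=> [|k IH] r r01.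
  by have /andP[] := V01 r r01.
have sub t : 0 < t < rho -> 0 < t < 1.
  by move=> /andP[-> tr]; exact: lt_le_trans rho1.
have [cw cf _ wM] := picard_below k; have [cw' cf' wg _] := picard_below k.+1.
have w_lim := continuous_at_left (a := rho) cw'.
have d_lim : picard_deriv n lambda k.+1 t @[t --> rho^'-] --> picard_deriv n lambda k.+1 rho.
  by apply: continuous_at_left; exact: continuous_green_deriv.
have fle t : 0 < t < rho -> reaction lambda (picard n lambda k) t <= fV t.
  move=> t01; apply: le_trans (fV_ge t t01).
  rewrite /reaction clamp_id; last by case/andP: (sub t t01) => /ltW -> /ltW ->.
  by apply: reaction_le => //; [exact: IH|case/andP: (V01 t t01)].
have wV1 : picard n lambda k.+1 rho <= V1.
  apply: le_trans gV; rewrite -subr_ge0.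
  apply: (cvg_at_left_le rho0 (cvgB vg w_lim)) => t /sub t01.
  by rewrite /= subr_ge0; have [] := wg t t01.
have pd : pV1 <= picard_deriv n lambda k.+1 rho.
  apply: (le_trans pP); rewrite -subr_ge0.
  apply: (cvg_at_left_le rho0 (cvgB d_lim vP)) => t /sub t01.
  by rewrite /= subr_ge0; have [] := wg t t01.
by have [] := polar_le (picard_polar rho cf) polV fle w_lim vV wV1 d_lim vpV pd r01.
Qed.

Let B := lambda / (1 - M) ^+ 2.
Let L := B + n.+1%:R * B.

Lemma reaction_bound k r : `|reaction lambda (picard n lambda k) r| <= B.
Proof.
have [_ _ _ /(_ _ (clamp01 r))/andP[_ wM]] := picard_below k.
rewrite ger0_norm; first exact: reaction_le.
by rewrite divr_ge0 ?(ltW l0) // exprn_ge0 // subr_ge0 (le_trans wM) // ltW.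
Qed.

(** A Lipschitz bound uniform in [k] survives in the pointwise limit and makes it
    continuous. *)
Lemma picard_lipschitz k x y : 0 <= x <= 1 -> 0 <= y <= 1 ->
  `|picard n lambda k x - picard n lambda k y| <= L * `|x - y|.
Proof.
have i01 : 0 <= (1 : R) <= 1 by rewrite ler01 lexx.
have B0 : 0 <= B by rewrite divr_ge0 ?(ltW l0) // exprn_ge0 // subr_ge0 ltW.
have L0 : 0 <= L by rewrite addr_ge0 // mulr_ge0.
wlog xy : x y / x <= y.
  move=> h x01 y01; have [xy|/ltW yx] := leP x y; first exact: h.
  by rewrite distrC [`|x - y|]distrC; exact: h.
move=> /andP[x0 x1] /andP[y0 y1].
case: k => [|k]; first by rewrite subrr normr0 mulr_ge0.
have [_ cf _ _] := picard_below k; have [cw _ _ _] := picard_below k.+1.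
set f := reaction lambda (picard n lambda k) in cf.
have [|t] := @MVT_segment R (picard n lambda k.+1) (picard_deriv n lambda k.+1) x y xy _
    (continuous_subspaceT cw).
  move=> t; rewrite in_itv /= => /andP[xt _].
  by apply: is_derive_green => //; exact: le_lt_trans xt.
rewrite in_itv /= => /andP[xt ty] E.
have t0 : 0 <= t by exact: le_trans xt.
have t1 : t <= 1 by exact: le_trans y1.
rewrite -normrN opprB E normrM [`|x - y|]distrC ler_wpM2r //.
have tn : `|t| <= 1 by rewrite ger0_norm.
rewrite /picard_deriv /green_deriv normrM -[leRHS]mul1r; apply: ler_pM => //.
apply: average_bound; [exact: continuous_green_laplacian|by rewrite t0|].
have fB s : 0 <= s <= 1 -> `|f s| <= B by move=> _; exact: reaction_bound.
have pB s : 0 <= s <= 1 -> `|radial_primitive n f s| <= B.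
  move=> s01; apply: moment_bound => //; first exact: continuous_average.
  by move=> v v01; exact: average_bound.
move=> s s01; rewrite (le_trans (ler_normB _ _)) // lerD ?pB //.
rewrite normrM [`|n.+1%:R|]ger0_norm // ler_wpM2l //; apply: average_bound => //.
exact: continuous_radial_primitive.
Qed.

(** The iterates increase and are bounded by [M < 1], hence converge; the limit
    passes through the reaction, which is continuous, and through the Green
    operator, by dominated convergence. *)
Lemma picard_fixpoint : exists f,
  [/\ continuous f, forall r, f r = reaction lambda (green n f) r,
    forall r, 0 <= r <= 1 -> picard n lambda k r @[k --> \oo] --> green n f r &
    forall r, 0 <= r <= 1 -> 0 <= green n f r <= M].
Proof.
have i01 : 0 <= (1 : R) <= 1 by rewrite ler01 lexx.
have B0 : 0 <= B by rewrite divr_ge0 ?(ltW l0) // exprn_ge0 // subr_ge0 ltW.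
have L0 : 0 <= L by rewrite addr_ge0 // mulr_ge0.
pose v r := limn (fun k => picard n lambda k (clamp r)).
have vl r : picard n lambda k (clamp r) @[k --> \oo] --> v r.
  apply: nondecreasing_is_cvgn.
    by apply/nondecreasing_seqP => k; apply: picard_nondecreasing; exact: clamp01.
  exists M => _ [k _ <-]; have [_ _ _ /(_ _ (clamp01 r))/andP[]] := picard_below k.
  by [].
have vM r : 0 <= v r <= M.
  have wM k : 0 <= picard n lambda k (clamp r) <= M.
    by have [_ _ _ /(_ _ (clamp01 r))] := picard_below k.
  apply/andP; split; [apply: (cvgr_to_ge (vl r))|apply: (cvgr_to_le (vl r))];
    by apply: nearW => k; have /andP[] := wM k.
have vclamp r : v (clamp r) = v r by rewrite /v [clamp (clamp r)]clamp_id // clamp01.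
have vlip x y : `|v x - v y| <= L * `|clamp x - clamp y|.
  apply: (cvgr_to_le (cvg_norm (cvgB (vl x) (vl y)))).
  by apply: nearW => k; apply: picard_lipschitz; exact: clamp01.
have cv : continuous v.
  move=> x; apply/cvgrPdist_lt => e e0.
  have L1 : 0 < L + 1 by rewrite ltr_wpDl.
  have eL : 0 < e / (L + 1) by rewrite divr_gt0.
  have /cvgrPdist_lt /(_ _ eL) clx := @continuous_clamp R x.
  apply: filterS clx => y clx; apply: le_lt_trans (vlip x y) _.
  apply: (@le_lt_trans _ _ ((L + 1) * `|clamp x - clamp y|)).
    by rewrite ler_wpM2r // lerDl.
  by rewrite -ltr_pdivlMl // mulrC.
pose f := reaction lambda v.
have cf : continuous f.
  apply: continuous_reaction.
    by move=> r; apply: continuous_comp; [exact: continuous_clamp|exact: cv].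
  by move=> r _; have /andP[_ h] := vM r; exact: le_lt_trans M1.
have bc : bounded_cvg (fun k => reaction lambda (picard n lambda k)) f.
  split => //.
  - by move=> k; have [] := picard_below k.
  - by exists B => k t _; exact: reaction_bound.
  - move=> t t01; apply: cvgMr; apply: cvgV.
      rewrite expf_neq0 // gt_eqF // subr_gt0.
      by have /andP[_ h] := vM (clamp t); exact: le_lt_trans M1.
    have h : 1 - picard n lambda k (clamp t) @[k --> \oo] --> 1 - v (clamp t).
      by rewrite vclamp; apply: cvgB; [exact: cvg_cst|exact: vl].
    by under eq_fun do rewrite expr2; rewrite expr2; apply: cvgM.
have Gv r : 0 <= r <= 1 -> green n f r = v r.
  move=> r01; have := bounded_cvg_lim (bounded_cvg_green n bc) r01 => h1.
  have h2 : picard n lambda k.+1 r @[k --> \oo] --> v r.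
    by have := vl r; rewrite clamp_id // => h; rewrite (cvg_shiftS (fun k => picard n lambda k r)).
  exact: (cvg_unique _ h1 h2).
exists f; split => //.
- by move=> r; rewrite /f /reaction Gv ?clamp01.
- by move=> r r01; rewrite Gv //; have := vl r; rewrite clamp_id.
- by move=> r r01; rewrite Gv.
Unshelve. all: by end_near. Qed.

End BelowProfile.

End PicardIteration.

(** * Minimal solutions lie below supersolutions *)

Section MinimalSolutionBarrier.
Context {R : realType}.
Implicit Types (f g w V P H q : R -> R) (n k : nat) (r t lambda M rho c : R).

Lemma eq_polar n rho w p H q f g : (forall r, 0 < r < rho -> f r = g r) ->
  polar n rho w p H q f -> polar n rho w p H q g.
Proof.
move=> fg [a1 a2 a3 a4 a5 a6]; split => //.
by move=> r hr; rewrite -fg //; exact: a4.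
Qed.

(** This vanishes with its derivative at [1] and has constant bilaplacian, which
    makes it the subsolution for the strict positivity in green_gt0. *)
Lemma polar_bump n c rho : polar n rho
  (fun r => c * (1 - r ^+ 2) ^+ 2)
  (fun r => c * (- 4 * r + 4 * r ^+ 3))
  (fun r => c * (- 4 * n.+1%:R + 4 * n.+3%:R * r ^+ 2))
  (fun r => c * (8 * n.+3%:R * r))
  (fun=> c * (8 * n.+3%:R * n.+1%:R)).
Proof.
have pw m r : is_derive r 1 (fun t : R => t ^+ m) (m%:R * r ^+ m.-1).
  exact: is_derive_pow.
have id1 r : is_derive r 1 (fun t : R => t) 1 by exact: is_derive_id.
have cst a r : is_derive r 1 (fun=> a : R) 0 by exact: is_derive_const.
have lim0 (a b : R) (h : R -> R) : h = (fun t => t * (a + b * t ^+ 2)) ->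
    t ^+ n * h t @[t --> 0^'+] --> (0 : R).
  move=> ->; apply: cvg_at_right_filter.
  have : t ^+ n * (t * (a + b * t ^+ 2)) @[t --> 0] --> 0 ^+ n * (0 * (a + b * 0 ^+ 2)).
    apply: cvgM; first exact: exprn_continuous.
    apply: cvgM; first exact: cvg_id.
    apply: cvgD; first exact: cvg_cst.
    by apply: cvgMr; exact: exprn_continuous.
  by rewrite mul0r mulr0.
split.
- move=> r _; apply: is_derive_scale.
  have h := is_derive_sub (cst 1 r) (pw 2 r).
  have := is_derive_mul h h => hh.
  by apply: (is_derive_eq hh); rewrite /= expr1; ring.
- move=> r _.
  have -> : (fun t : R => t ^+ n * (c * (- 4 * t + 4 * t ^+ 3))) =
      (fun t => c * (- 4 * t ^+ n.+1 + 4 * t ^+ n.+3)).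
    by apply/funext => t; rewrite !exprS expr0; ring.
  apply: (is_derive_eq (is_derive_scale c (is_derive_add
    (is_derive_scale (- 4) (pw n.+1 r)) (is_derive_scale 4 (pw n.+3 r))))).
  by rewrite /= !exprS expr0; ring.
- move=> r _; apply: is_derive_scale.
  have h := is_derive_add (cst (- 4 * n.+1%:R) r)
    (is_derive_scale (4 * n.+3%:R) (pw 2 r)).
  by apply: (is_derive_eq h); rewrite /= expr1; ring.
- move=> r _.
  have -> : (fun t : R => t ^+ n * (c * (8 * n.+3%:R * t))) =
      (fun t => c * (8 * n.+3%:R * t ^+ n.+1)).
    by apply/funext => t; rewrite !exprS; ring.
  apply: (is_derive_eq (is_derive_scale c (is_derive_scale (8 * n.+3%:R) (pw n.+1 r)))).
  by rewrite /=; ring.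
- by apply: (lim0 (- 4 * c) (4 * c)); apply/funext => t; rewrite !exprS expr0; ring.
- by apply: (lim0 (c * 8 * n.+3%:R) 0); apply/funext => t; ring.
Qed.

Lemma green_gt0 n f c : continuous f -> 0 < c -> (forall r, 0 < r < 1 -> c <= f r) ->
  forall r, 0 <= r < 1 -> 0 < green n f r.
Proof.
move=> cf c0 fc.
(* the factor for which the bump has bilaplacian [c] *)
pose d := c / (8 * n.+3%:R * n.+1%:R).
have d0 : 0 < d by rewrite divr_gt0 // !mulr_gt0.
have cb : continuous (fun r : R => d * (1 - r ^+ 2) ^+ 2).
  move=> r; apply: (@continuousM R _ (fun=> d) (fun r : R => (1 - r ^+ 2) ^+ 2)).
    exact: cst_continuous.
  apply: (@continuous_comp _ _ _ (fun t : R => 1 - t ^+ 2) (fun s => s ^+ 2)).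
    apply: continuousB.
      exact: cst_continuous.
    exact: exprn_continuous.
  exact: exprn_continuous.
have cG := continuous_green (n := n) cf.
have le r : 0 <= r <= 1 -> 0 <= green n f r - d * (1 - r ^+ 2) ^+ 2.
  apply: (ge_on_closed_unit (f := fun r => green n f r - d * (1 - r ^+ 2) ^+ 2)).
    by move=> t; apply: continuousB; [exact: cG|exact: cb].
  move=> t t01; rewrite subr_ge0.
  have fle s : 0 < s < 1 -> d * (8 * n.+3%:R * n.+1%:R) <= f s.
    by move=> s01; rewrite divfK ?fc // !mulf_neq0.
  have b1 : d * (1 - s ^+ 2) ^+ 2 @[s --> 1^'-] --> (0 : R).
    have := continuous_at_left (a := 1) cb.
    by rewrite expr1n subrr expr0n mulr0.
  have b2 : d * (- 4 * s + 4 * s ^+ 3) @[s --> 1^'-] --> (0 : R).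
    have := @continuous_at_left _ (fun s : R => d * (- 4 * s + 4 * s ^+ 3)) 1.
    rewrite expr1n !mulr1 addNr mulr0; apply => s.
    apply: cvgMr; apply: cvgD; apply: cvgMr; [exact: cvg_id|exact: exprn_continuous].
  by have [] := polar_le (polar_bump n d 1) (polar_green n 1 cf) fle b1
    (cvg_green1 n cf) (lexx 0) b2 (cvg_green_deriv1 n cf) (lexx 0) t01.
move=> r /andP[r0 r1]; apply: (@lt_le_trans _ _ (d * (1 - r ^+ 2) ^+ 2)).
  by rewrite mulr_gt0 // exprn_gt0 // subr_gt0 expr_lt1.
by rewrite -subr_ge0 le // r0 ltW.
Qed.

Lemma cvg_ray_center n k (u : 'rV[R]_n.+1 -> R) : Ck_on k unit_ball u ->
  u (t *: axis) @[t --> 0^'+] --> u 0.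
Proof.
move=> Cu; apply: cvg_at_right_filter.
have c0 : {for (0 : R) *: axis, continuous u}.
  by apply: Ck_cont Cu _; apply: ray_in_ball; rewrite lexx ltr01.
have h : u (t *: axis) @[t --> 0] --> u ((0 : R) *: axis).
  exact: (@continuous_comp _ _ _ (fun t : R => t *: axis) u 0 (@scalel_continuous _ _ _ _) c0).
by move: h; rewrite [X in _ --> u X -> _]scale0r.
Qed.

Context (n : nat) (lambda : R) (u : 'rV[R]_n.+1 -> R).
Context (n0 : (0 < n)%N) (l0 : 0 < lambda) (minu : minimal_solution lambda u).

Let g r := u (r *: axis).
Let P r := partial ord0 u (r *: axis).

Lemma minimal_solution_polar : polar n 1 g P
  (fun r => laplacian u (r *: axis)) (fun r => partial ord0 (laplacian u) (r *: axis))
  (fun r => lambda / (1 - g r) ^+ 2).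
Proof.
have [[C4 _ eqf _ _] _] := minu.
have ru : radial_on_ball u by move=> x y; exact: minimal_solution_radial minu.
apply: eq_polar (polar_ray n0 C4 ru) => r /andP[r0 r1].
by rewrite eqf //; apply: ray_in_ball; rewrite ltW.
Qed.

(** The bilaplacian is positive and the boundary data vanish, so by comparison
    the profile decreases. *)
Lemma minimal_solution_center r : 0 < r < 1 -> g r <= u 0.
Proof.
move=> /andP[r0 r1]; have [cu _] := minu; have [C4 _ _ _ _] := cu.
have [g1 P1] := ray_boundary cu.
have pol := minimal_solution_polar.
have f0 t : 0 < t < 1 -> 0 <= lambda / (1 - g t) ^+ 2.
  by move=> _; rewrite divr_ge0 ?(ltW l0) // sqr_ge0.
have P_le0 t : 0 < t < 1 -> P t <= 0.
  by move=> t01; have [] := polar_comparison pol f0 g1 (lexx 0) P1 (lexx 0) t01.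
have g0 := cvg_ray_center C4.
apply: (cvg_at_right_le r0 g0) => t /andP[t0 tr].
rewrite -lerN2; apply: (@le_of_derive_oo R (fun s => - g s) (fun s => - P s) 1) => //.
- by move=> s s01; have [d _ _ _ _ _] := pol; have := d s s01 => ?; exact: is_deriveN.
- exact: ltW.
- move=> s /andP[ts sr]; rewrite oppr_ge0 P_le0 // (lt_trans t0) //=.
  exact: lt_trans r1.
Qed.

(** The Picard iterates stay below [V] and converge to a classical solution;
    minimality puts the solution below their limit.  Their common bound [M] is
    the value of the solution at the centre, which is less than [1]. *)
Lemma minimal_solution_barrier rho V pV HV qV fV (V1 pV1 g1 P1 : R) : 0 < rho <= 1 ->
  polar n rho V pV HV qV fV -> (forall r, 0 < r < rho -> 0 <= V r < 1) ->
  (forall r, 0 < r < rho -> lambda / (1 - V r) ^+ 2 <= fV r) ->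
  V t @[t --> rho^'-] --> V1 -> pV t @[t --> rho^'-] --> pV1 ->
  g t @[t --> rho^'-] --> g1 -> P t @[t --> rho^'-] --> P1 ->
  g1 <= V1 -> pV1 <= P1 ->
  forall r, 0 < r < rho -> g r <= V r.
Proof.
move=> rho01 polV V01 fV_ge vV vpV vg vP gV pP r r01.
have [cu minu'] := minu; have [C4 _ _ u01 _] := cu.
have [b1 b2] := ray_boundary cu.
have u0B : unit_ball (0 : 'rV[R]_n.+1) by rewrite /unit_ball /= enorm0.
have /andP[u00 u01'] := u01 _ u0B.
have prof : profile n lambda (u 0) g P (fun r => laplacian u (r *: axis))
    (fun r => partial ord0 (laplacian u) (r *: axis)).
  exact: Profile minimal_solution_polar b1 b2 minimal_solution_center.
have g0 t : 0 < t < 1 -> 0 <= g t.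
  move=> /andP[t0 t1]; have tB : unit_ball (t *: (axis : 'rV[R]_n.+1)).
    by apply: ray_in_ball; rewrite ltW.
  by have /andP[/ltW] := u01 _ tB.
have [f [cf fE fl fM]] := picard_fixpoint l0 (ltW u00) u01' g0 prof.
have fc t : 0 < t < 1 -> lambda <= f t.
  move=> _; rewrite fE /reaction.
  have /andP[w0 wM] := fM _ (clamp01 t).
  have w1 : green n f (clamp t) < 1 by exact: le_lt_trans u01'.
  rewrite ler_pdivlMr ?exprn_gt0 ?subr_gt0 // ler_piMr ?(ltW l0) //.
  by rewrite exprn_ile1 // ?subr_ge0 ?(ltW w1) // lerBlDr lerDl.
have solv : classical_solution lambda (fun x : 'rV[R]_n.+1 => green n f (enorm x)).
  apply: green_classical_solution => // t t01.
  rewrite (green_gt0 n cf l0 fc t01) /=; case/andP: t01 => t0 t1.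
  have /andP[_ h] := fM t (introT andP (conj t0 (ltW t1))); exact: le_lt_trans u01'.
have [r0 rrho] := andP r01; have [rho0 rho1] := andP rho01.
have r1 : r < 1 by exact: lt_le_trans rho1.
have rB : unit_ball (r *: (axis : 'rV[R]_n.+1)) by apply: ray_in_ball; rewrite ltW.
have := minu' _ solv _ rB; rewrite enorm_ray gtr0_norm // => h; apply: le_trans h _.
have r01' : 0 <= r <= 1 by rewrite !ltW.
apply: (cvgr_to_le (fl r r01')); apply: nearW => k.
exact: (picard_le_barrier l0 (ltW u00) u01' g0 prof rho01 polV V01 fV_ge vV vpV vg vP
  gV pP).
Qed.

End MinimalSolutionBarrier.

(** * The barrier *)

Section ExplicitBarrier.
Context {R : realType}.
Implicit Types (r t e c A B D C y z rho : R) (n k : nat).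

Lemma cube_rootK r : 0 <= r -> (r `^ (1 / 3)) ^+ 3 = r.
Proof.
move=> r0; rewrite -powR_mulrn ?powR_ge0 // -powRrM.
by rewrite (_ : 1 / 3 * 3%:R = 1) ?powRr1 //; field.
Qed.

Lemma powR_third r k : 0 <= r -> r `^ (k%:R / 3) = (r `^ (1 / 3)) ^+ k.
Proof.
move=> r0; rewrite -powR_mulrn ?powR_ge0 // -powRrM; congr (_ `^ _); ring.
Qed.

Lemma powRN_third r k : 0 <= r -> r `^ (- (k%:R / 3)) = (r `^ (1 / 3)) ^- k.
Proof. by move=> r0; rewrite powRN powR_third. Qed.

Lemma is_derive_pow_powR n e e' r : 0 < r -> e' = e - 1 ->
  is_derive r 1 (fun t => t ^+ n * t `^ e) ((n%:R + e) * (r ^+ n * r `^ e')).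
Proof.
move=> r0 ->; have h := is_derive_mul (is_derive_pow n r) (is_derive1_powR e r0).
apply: (is_derive_eq h).
have -> : r `^ e = r * r `^ (e - 1).
  have -> : r * r `^ (e - 1) = r `^ 1 * r `^ (e - 1) by rewrite powRr1 // ltW.
  by rewrite -powRD ?(gt_eqF r0) ?implybT // addrCA subrr addr0.
by case: n {h} => [|n] /=; rewrite ?exprS ?expr0; ring.
Qed.

Lemma cvg_pow_powR n e : 0 < n%:R + e -> t ^+ n * t `^ e @[t --> 0^'+] --> (0 : R).
Proof.
move=> h; apply: cvg_trans (powR_cvg0 h); apply: near_eq_cvg; near=> t.
have t0 : 0 < t by near: t; exact: nbhs_right_gt.
by rewrite powRD ?gt_eqF ?implybT // powR_mulrn // ltW.
Unshelve. all: by end_near. Qed.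

(** In dimension [n + 1] the bilaplacian annihilates [1 - D - B * r ^ 2] and maps
    [- r ^ (4/3)] to [lambda_bar * r ^ (- 8/3)], the power that the equation
    requires as [(r ^ (4/3)) ^ (- 2)].  The fluxes vanish at the origin from
    dimension three on. *)
Lemma polar_barrier n A B D rho : (1 < n)%N -> polar n rho
  (fun r => 1 - D - A * r `^ (4 / 3) - B * r ^+ 2)
  (fun r => - (4 / 3 * A) * r `^ (1 / 3) - 2 * B * r)
  (fun r => - (4 / 3 * (n%:R + 1 / 3) * A) * r `^ (- (2 / 3)) - 2 * n.+1%:R * B)
  (fun r => 8 / 9 * (n%:R + 1 / 3) * A * r `^ (- (5 / 3)))
  (fun r => 8 / 9 * (n%:R + 1 / 3) * (n%:R - 5 / 3) * A * r `^ (- (8 / 3))).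
Proof.
move=> n1; have n2 : (2 : R) <= n%:R by rewrite ler_nat.
have pr e e' r : 0 < r -> e' = e - 1 -> is_derive r 1 (fun t => t `^ e) (e * r `^ e').
  by move=> r0 ->; exact: is_derive1_powR.
split.
- move=> r /andP[r0 _].
  have e1 : (1 / 3 : R) = 4 / 3 - 1 by field.
  apply: (is_derive_eq (is_derive_sub (is_derive_sub (is_derive_const (1 - D) r)
    (is_derive_scale A (pr _ _ r r0 e1))) (is_derive_scale B (is_derive_pow 2 r)))).
  by rewrite /= expr1; field.
- move=> r /andP[r0 _].
  have e1 : (- (2 / 3) : R) = 1 / 3 - 1 by field.
  have -> : (fun t : R => t ^+ n * (- (4 / 3 * A) * t `^ (1 / 3) - 2 * B * t)) =
      (fun t => - (4 / 3 * A) * (t ^+ n * t `^ (1 / 3)) - 2 * B * t ^+ n.+1).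
    by apply/funext => t; rewrite exprS; ring.
  apply: (is_derive_eq (is_derive_sub
    (is_derive_scale (- (4 / 3 * A)) (is_derive_pow_powR n r0 e1))
    (is_derive_scale (2 * B) (is_derive_pow n.+1 r)))).
  by rewrite /=; field.
- move=> r /andP[r0 _].
  have e1 : (- (5 / 3) : R) = - (2 / 3) - 1 by field.
  apply: (is_derive_eq (is_derive_sub (is_derive_scale _ (pr _ _ r r0 e1))
    (is_derive_const (2 * n.+1%:R * B) r))).
  by field.
- move=> r /andP[r0 _].
  have e1 : (- (8 / 3) : R) = - (5 / 3) - 1 by field.
  set c := 8 / 9 * (n%:R + 1 / 3) * A.
  have -> : (fun t : R => t ^+ n * (c * t `^ (- (5 / 3)))) =
      (fun t => c * (t ^+ n * t `^ (- (5 / 3)))).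
    by apply/funext => t; ring.
  apply: (is_derive_eq (is_derive_scale c (is_derive_pow_powR n r0 e1))).
  by rewrite /c; ring.
- have -> : (fun t : R => t ^+ n * (- (4 / 3 * A) * t `^ (1 / 3) - 2 * B * t)) =
      (fun t => - (4 / 3 * A) * (t ^+ n * t `^ (1 / 3)) - 2 * B * t ^+ n.+1).
    by apply/funext => t; rewrite exprS; ring.
  have p0 : - (4 / 3 * A) * (t ^+ n * t `^ (1 / 3)) @[t --> 0^'+] --> - (4 / 3 * A) * 0.
    by apply: cvgMr; apply: cvg_pow_powR; lra.
  have p1 : 2 * B * t ^+ n.+1 @[t --> 0^'+] --> 2 * B * 0 ^+ n.+1.
    by apply: cvgMr; apply: cvg_at_right_filter; exact: exprn_continuous.
  have : - (4 / 3 * A) * (t ^+ n * t `^ (1 / 3)) - 2 * B * t ^+ n.+1 @[t --> 0^'+] -->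
      - (4 / 3 * A) * 0 - 2 * B * 0 ^+ n.+1 by exact: cvgB.
  by rewrite expr0n /= !mulr0 subrr.
- have -> : (fun t : R => t ^+ n * (8 / 9 * (n%:R + 1 / 3) * A * t `^ (- (5 / 3)))) =
      (fun t => 8 / 9 * (n%:R + 1 / 3) * A * (t ^+ n * t `^ (- (5 / 3)))).
    by apply/funext => t; ring.
  have : 8 / 9 * (n%:R + 1 / 3) * A * (t ^+ n * t `^ (- (5 / 3))) @[t --> 0^'+] -->
      8 / 9 * (n%:R + 1 / 3) * A * 0.
    by apply: cvgMr; apply: cvg_pow_powR; lra.
  by rewrite mulr0.
Qed.

Lemma first_contact (d : R -> R) (r0 b : R) :
  (forall r, r0 <= r < b -> {for r, continuous d}) -> 0 < d r0 -> r0 < b ->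
  (forall r, r0 <= r < b -> 0 < d r) \/
  exists rho, [/\ r0 < rho < b, d rho = 0 & forall r, r0 <= r < rho -> 0 < d r].
Proof.
move=> cd d0 r0b.
have [|] := pselect (forall r, r0 <= r < b -> 0 < d r); first by left.
move=> /existsNP[s /not_implyP[/andP[r0s sb] /negP]]; rewrite -leNgt => ds; right.
pose S := [set r | r0 <= r < b /\ d r <= 0].
have Ss : S s by split => //; rewrite r0s.
have lbS : lbound S r0 by move=> r [/andP[]].
have hS : has_inf S by split; [exists s|exists r0].
have r0i : r0 <= inf S by apply: lb_le_inf => //; exists s.
have is_ : inf S <= s by apply: ge_inf => //; exists r0.
have ib : inf S < b by exact: le_lt_trans sb.
have pos r : r0 <= r < inf S -> 0 < d r.
  move=> /andP[r0r ri]; rewrite ltNge; apply/negP => dr.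
  have : inf S <= r.
    apply: ge_inf; first by exists r0.
    by split => //; rewrite r0r (lt_trans ri).
  by rewrite leNgt ri.
have ci : {for inf S, continuous d} by apply: cd; rewrite r0i.
have di : d (inf S) <= 0.
  rewrite leNgt; apply/negP => dpos.
  have /cvgrPdist_lt /(_ _ dpos) [e /= e0 he] := ci.
  have [t St tlt] := inf_adherent e0 hS.
  have it : inf S <= t by apply: ge_inf => //; exists r0.
  have : `|d (inf S) - d t| < d (inf S).
    by apply: he; rewrite /ball_ /= distrC ger0_norm ?subr_ge0 //; lra.
  by have [_ dt] := St; rewrite ltr_norml => /andP[_ h]; lra.
have r0i' : r0 < inf S.
  by rewrite lt_neqAle r0i andbT; apply/eqP => e; move: di; rewrite -e leNgt d0.
exists (inf S); split => //; first by rewrite r0i'.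
apply/eqP; rewrite eq_le di /=.
have dl : d t @[t --> (inf S)^'-] --> d (inf S) by exact: cvg_at_left_filter ci.
by apply: (cvg_at_left_le r0i' dl) => t /andP[h1 h2]; apply: ltW; apply: pos; rewrite ltW.
Qed.

Lemma derive_le0_at_contact (d : R -> R) (r0 rho dd : R) : r0 < rho -> d rho = 0 ->
  (forall r, r0 <= r < rho -> 0 < d r) -> is_derive rho 1 d dd -> dd <= 0.
Proof.
move=> r0rho drho pos [der <-].
have : h^-1 *: ((d \o shift rho) (h *: 1) - d rho) @[h --> 0^'] --> 'D_1 d rho by exact: der.
move=> /cvg_dnbhs_at_left h; apply: (cvgr_to_le h); near=> t.
have t0 : t < 0 by near: t; exact: nbhs_left_lt.
have tr : r0 - rho < t by near: t; apply: nbhs_left_gt; rewrite subr_lt0.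
rewrite drho subr0 /= /GRing.scale /= mulr1 nmulr_rle0 ?invr_lt0 // ltW //.
by apply: pos; rewrite -lerBlDr (ltW tr) gtrDr.
Unshelve. all: by end_near. Qed.

End ExplicitBarrier.

(** * A bound at the centre of the ball *)

Section CenterBound.
Context {R : realType}.
Implicit Types (r t e c A B C y z rho lambda : R) (n k : nat).

(** The radius is the first one beyond [r0] at which [u] meets
    [U = 1 - C * r ^ (4/3)]: there [u] crosses from below, so its derivative is at
    least that of [U].  If they do not meet, the radius [1] serves, where [u] and
    its derivative vanish and [U] lies above [0] and decreases. *)
Lemma contact_radius n lambda (u : 'rV[R]_n.+1 -> R) C r0 :
  classical_solution lambda u -> 0 <= C -> 0 < r0 < 1 ->
  u (r0 *: axis) < 1 - C * r0 `^ (4 / 3) ->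
  exists rho g1 P1, [/\ r0 <= rho <= 1,
    u (t *: axis) @[t --> rho^'-] --> g1,
    partial ord0 u (t *: axis) @[t --> rho^'-] --> P1,
    0 <= g1 <= 1 - C * rho `^ (4 / 3) & - (4 / 3 * C) * rho `^ (1 / 3) <= P1].
Proof.
move=> cu C0 /andP[r00 r01] ur0; have [C4 _ _ u01 _] := cu.
have [b1 b2] := ray_boundary cu.
have C1 := Ck_first C4.
pose d t := 1 - C * t `^ (4 / 3) - u (t *: axis).
have dd t : 0 < t < 1 ->
    is_derive t 1 d (- (4 / 3 * C) * t `^ (1 / 3) - partial ord0 u (t *: axis)).
  move=> /andP[t0 t1]; apply: is_derive_sub; last first.
    by apply: is_derive_ray => //; rewrite ltW.
  have h := is_derive_sub (is_derive_const 1 t)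
    (is_derive_scale C (is_derive1_powR (4 / 3) t0)).
  apply: (is_derive_eq h); rewrite (_ : 4 / 3 - 1 = 1 / 3 :> R); last by field.
  ring.
have cd r : r0 <= r < 1 -> {for r, continuous d}.
  move=> /andP[r0r r1]; apply: is_derive_continuous (dd r _).
  by rewrite (lt_le_trans r00).
have d0 : 0 < d r0 by rewrite /d subr_gt0.
have [pos|[rho [/andP[r0rho rho1] drho pos]]] := first_contact cd d0 r01.
  exists 1, 0, 0; split => //; first by rewrite (ltW r01) lexx.
    rewrite lexx /= powR1 mulr1.
    have p1 : t `^ (4 / 3) @[t --> 1^'-] --> (1 : R) `^ (4 / 3).
      apply: cvg_at_left_filter.
      exact: (is_derive_continuous (is_derive1_powR (4 / 3) ltr01)).
    have p2 : d t @[t --> 1^'-] --> 1 - C * 1 `^ (4 / 3) - 0.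
      by apply: cvgB b1; apply: cvgB; [exact: cvg_cst|exact: cvgMr].
    rewrite powR1 mulr1 subr0 in p2.
    apply: (cvg_at_left_le r01 p2) => t /andP[h1 h2].
    by apply: ltW; apply: pos; rewrite ltW.
  by rewrite powR1 mulr1 oppr_le0 mulr_ge0.
have rho0 : 0 < rho by exact: lt_trans r0rho.
have rhoB : unit_ball (rho *: (axis : 'rV[R]_n.+1)) by apply: ray_in_ball; rewrite ltW.
have cont k (f : 'rV[R]_n.+1 -> R) : Ck_on k unit_ball f ->
    f (t *: axis) @[t --> rho^'-] --> f (rho *: axis).
  move=> Cf; apply: cvg_at_left_filter.
  exact: (@continuous_comp _ _ _ (fun t : R => t *: axis) f rho
    (@scalel_continuous _ _ _ _) (Ck_cont Cf rhoB)).
exists rho, (u (rho *: axis)), (partial ord0 u (rho *: axis)); split.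
- by rewrite !ltW.
- exact: cont C4.
- exact: cont (Ck_partial ord0 C1).
- have /andP[/ltW -> _] := u01 _ rhoB; rewrite /=.
  by move: drho; rewrite /d; lra.
- rewrite -subr_le0; apply: (derive_le0_at_contact r0rho drho pos).
  by apply: dd; rewrite rho0.
Qed.

(** The barrier is [V = (1 - e) * U + e * P] with [U = 1 - C * r ^ (4/3)] and [P]
    the polynomial [1 - C/3 * rho ^ (4/3) - 2/3 * C * rho ^ (- 2/3) * r ^ 2],
    which has the value and the slope of [U] at the contact radius [rho].  In
    the variables [y = rho ^ (1/3)] and [z = r ^ (1/3)] all exponents become
    integers. *)
Lemma center_bound n lambda (u : 'rV[R]_n.+1 -> R) C e r0 : (3 < n)%N ->
  minimal_solution lambda u -> 0 < lambda -> 0 < C -> 0 < e < 1 ->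
  lambda <= (1 - e) * C ^+ 3 * lambda_bar R n.+1 -> 0 < r0 < 1 ->
  u (r0 *: axis) < 1 - C * r0 `^ (4 / 3) ->
  u 0 <= 1 - e * C / 3 * r0 `^ (4 / 3).
Proof.
move=> n3 minu l0 C0 /andP[e0 e1] hl r01 ur0.
have [cu _] := minu; have [C4 _ _ _ _] := cu.
have [rho [g1 [P1 [/andP[r0rho rho1] gl Pl /andP[g10 g1U] PU]]]] :=
  contact_radius cu (ltW C0) r01 ur0.
have [r00 r0lt1] := andP r01.
have rho0 : 0 < rho by exact: lt_le_trans r0rho.
pose y := rho `^ (1 / 3).
have y0 : 0 < y by rewrite powR_gt0.
have third k r : 0 < r -> r `^ (k%:R / 3) = (r `^ (1 / 3)) ^+ k.
  by move=> /ltW; exact: powR_third.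
have yr4 : rho `^ (4 / 3) = y ^+ 4 by rewrite (third 4%N).
have rho_y : rho = y ^+ 3 by rewrite cube_rootK // ltW.
(* the coefficients of [V = 1 - D - A * r ^ (4/3) - B * r ^ 2] *)
pose A := (1 - e) * C.
pose D := e * C / 3 * y ^+ 4.
pose B := 2 * e * C / 3 / y ^+ 2.
have A0 : 0 < A by rewrite mulr_gt0 // subr_gt0.
have D0 : 0 < D by rewrite !mulr_gt0 ?exprn_gt0.
have B0 : 0 < B by rewrite !mulr_gt0 ?invr_gt0 ?exprn_gt0.
have polV := polar_barrier A B D rho (ltn_trans (isT : 1 < 3)%N n3).
have zE r : 0 < r -> exists2 z, 0 < z & [/\ r = z ^+ 3, r `^ (1 / 3) = z,
    r `^ (4 / 3) = z ^+ 4 & r `^ (- (8 / 3)) = z ^- 8].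
  move=> r_gt0; exists (r `^ (1 / 3)); first by rewrite powR_gt0.
  by split; rewrite ?cube_rootK ?(third 4%N) // ?(powRN_third 8%N) // ltW.
have V1E : 1 - D - A * y ^+ 4 - B * rho ^+ 2 = 1 - C * y ^+ 4.
  by rewrite rho_y /D /A /B; field; rewrite gt_eqF.
have zy r z : r < rho -> 0 < z -> r = z ^+ 3 -> z <= y.
  move=> rrho z0 rE; rewrite leNgt; apply/negP => yz.
  move: rrho; rewrite rE rho_y ltNge lerXn2r ?nnegrE ?ltW //.
have V01 r : 0 < r < rho -> 0 <= 1 - D - A * r `^ (4 / 3) - B * r ^+ 2 < 1.
  move=> /andP[r_gt0 rrho]; have [z z0 [rE _ r4 _]] := zE r r_gt0.
  have zley := zy r z rrho z0 rE.
  rewrite r4 rE; apply/andP; split; last first.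
    have := mulr_gt0 A0 (exprn_gt0 4 z0); have := mulr_gt0 B0 (exprn_gt0 2 (exprn_gt0 3 z0)).
    by move: D0; lra.
  have h : 0 <= 1 - D - A * y ^+ 4 - B * rho ^+ 2 by rewrite V1E -yr4; lra.
  apply: le_trans h _; rewrite rho_y.
  have pw k : z ^+ k <= y ^+ k by apply: lerXn2r; rewrite ?nnegrE ?(ltW z0) ?(ltW y0).
  have h1 : A * z ^+ 4 <= A * y ^+ 4 by rewrite ler_pM2l.
  have h2 : B * (z ^+ 3) ^+ 2 <= B * (y ^+ 3) ^+ 2 by rewrite ler_pM2l // -!exprM.
  by lra.
have nR : (4 : R) <= n%:R by rewrite ler_nat.
have lbar : lambda_bar R n.+1 = 8 / 9 * (n%:R + 1 / 3) * (n%:R - 5 / 3).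
  by rewrite /lambda_bar -natr1; field.
have fV r : 0 < r < rho -> lambda / (1 - (1 - D - A * r `^ (4 / 3) - B * r ^+ 2)) ^+ 2 <=
    8 / 9 * (n%:R + 1 / 3) * (n%:R - 5 / 3) * A * r `^ (- (8 / 3)).
  move=> /andP[r_gt0 rrho]; have [z z0 [rE _ r4 r8]] := zE r r_gt0.
  rewrite r4 r8 -lbar rE.
  (* [V <= U]: divided by [e * C / 3 / y ^ 2], the difference is
     [y ^ 6 - 3 * y ^ 2 * z ^ 4 + 2 * z ^ 6], with a double root at [z ^ 2 = y ^ 2] *)
  have amgm : C * z ^+ 4 <= D + A * z ^+ 4 + B * (z ^+ 3) ^+ 2.
    rewrite -subr_ge0.
    have -> : D + A * z ^+ 4 + B * (z ^+ 3) ^+ 2 - C * z ^+ 4 =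
        e * C / 3 / y ^+ 2 * ((y ^+ 2 - z ^+ 2) ^+ 2 * (y ^+ 2 + 2 * z ^+ 2)).
      by rewrite /D /A /B; field; rewrite gt_eqF.
    apply: mulr_ge0.
      by rewrite divr_ge0 ?sqr_ge0 // divr_ge0 // mulr_ge0 // ltW.
    by rewrite mulr_ge0 ?sqr_ge0 // addr_ge0 ?sqr_ge0 // mulr_ge0 ?sqr_ge0.
  have Cz : 0 < C * z ^+ 4 by rewrite mulr_gt0 // exprn_gt0.
  have -> : 1 - (1 - D - A * z ^+ 4 - B * (z ^+ 3) ^+ 2) =
      D + A * z ^+ 4 + B * (z ^+ 3) ^+ 2 by ring.
  have W0 := lt_le_trans Cz amgm.
  apply: (@le_trans _ _ (lambda / (C * z ^+ 4) ^+ 2)).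
    rewrite ler_pM2l // lef_pV2 ?posrE ?exprn_gt0 //.
    by apply: lerXn2r => //; rewrite nnegrE ltW.
  rewrite ler_pdivrMr ?exprn_gt0 //.
  have -> : lambda_bar R n.+1 * A * z ^- 8 * (C * z ^+ 4) ^+ 2 =
      (1 - e) * C ^+ 3 * lambda_bar R n.+1.
    by rewrite /A; field; rewrite gt_eqF.
  exact: hl.
have lim4 : t `^ (4 / 3) @[t --> rho^'-] --> rho `^ (4 / 3).
  apply: cvg_at_left_filter.
  exact: (is_derive_continuous (is_derive1_powR (4 / 3) rho0)).
have lim1 : t `^ (1 / 3) @[t --> rho^'-] --> rho `^ (1 / 3).
  apply: cvg_at_left_filter.
  exact: (is_derive_continuous (is_derive1_powR (1 / 3) rho0)).
have limV : 1 - D - A * t `^ (4 / 3) - B * t ^+ 2 @[t --> rho^'-] -->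
    1 - D - A * rho `^ (4 / 3) - B * rho ^+ 2.
  apply: cvgB; first by apply: cvgB; [exact: cvg_cst|exact: cvgMr].
  by apply: cvgMr; apply: cvg_at_left_filter; exact: exprn_continuous.
have limpV : - (4 / 3 * A) * t `^ (1 / 3) - 2 * B * t @[t --> rho^'-] -->
    - (4 / 3 * A) * rho `^ (1 / 3) - 2 * B * rho.
  apply: cvgB; first exact: cvgMr.
  by apply: cvgMr; apply: cvg_at_left_filter; exact: cvg_id.
have gV : g1 <= 1 - D - A * rho `^ (4 / 3) - B * rho ^+ 2 by rewrite yr4 V1E -yr4.
have pP : - (4 / 3 * A) * rho `^ (1 / 3) - 2 * B * rho <= P1.
  apply: le_trans PU; rewrite -/y [in X in X <= _]rho_y.
  rewrite le_eqVlt; apply/orP; left; apply/eqP.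
  by rewrite /A /B; field; rewrite gt_eqF.
have rho01 : 0 < rho <= 1 by rewrite rho0.
have bar := minimal_solution_barrier (ltn_trans (isT : 0 < 3)%N n3) l0 minu rho01
  polV V01 fV limV limpV gl Pl gV pP.
have u0 := cvg_ray_center C4.
have uD : u 0 <= 1 - D.
  apply: (cvg_at_right_ge rho0 u0) => t /andP[t0 trho].
  apply: (le_trans (bar t _)); first by rewrite t0.
  have := mulr_gt0 A0 (powR_gt0 (4 / 3) t0); have := mulr_gt0 B0 (exprn_gt0 2 t0).
  by lra.
apply: (le_trans uD); rewrite lerD2l lerN2 /D -yr4.
apply: ler_wpM2l; first by rewrite !mulr_ge0 // ltW.
by apply: ge0_ler_powR => //; rewrite nnegrE ltW.
Qed.

Lemma minimal_solution_le_center n lambda (u : 'rV[R]_n.+1 -> R) x : (0 < n)%N ->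
  0 < lambda -> minimal_solution lambda u -> unit_ball x -> u x <= u 0.
Proof.
move=> n0 l0 minu xB; have [x0|xn0] := eqVneq (enorm x) 0.
  by rewrite (enorm_eq0 x0).
have x0 : 0 < enorm x by rewrite lt_def xn0 enorm_ge0.
rewrite (minimal_solution_radial minu xB (y := enorm x *: axis)).
  exact: (minimal_solution_center n0 l0 minu (introT andP (conj x0 xB))).
by rewrite enorm_ray gtr0_norm.
Qed.

End CenterBound.

Theorem theorem3p2 (R : realType) (N : nat) (hN : (5 <= N)%N)
    (ustar : 'rV[R]_N -> R) (lambda_star : R)
    (hext : extremal_pair ustar lambda_star)
    (hsing : singular ustar) :
  forall x : 'rV[R]_N, unit_ball x ->
    1 - ustar x <=
      (lambda_star / lambda_bar R N) `^ (1 / 3) * enorm x `^ (4 / 3).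
Proof.
case: N hN ustar hext hsing => [//|n] n4 ustar [hsup lsE [ul [ulmin ullim]]] hsing x xB.
have n3 : (3 < n)%N by [].
have n0 : (0 < n)%N by exact: ltn_trans n3.
have B0 : unit_ball (0 : 'rV[R]_n.+1) by rewrite /unit_ball /= enorm0.
have ls0 : 0 < lambda_star.
  have [[l [l0 hl]] ub] := hsup; apply: (lt_le_trans l0); rewrite lsE.
  by apply: ub_le_sup => //; split.
have near_ls : \forall l \near lambda_star^'-, 0 < l < lambda_star.
  near=> l; apply/andP; split; near: l; [exact: nbhs_left_gt|exact: nbhs_left_lt].
have us0 : 1 <= ustar 0.
  rewrite -hsing; apply: ge_sup; first by exists (ustar 0), 0.
  move=> _ [y yB <-].
  apply: (ler_cvg_to (ullim y yB) (ullim 0 B0)).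
  apply: filterS near_ls => l hl; have [l0 _] := andP hl.
  exact: minimal_solution_le_center n0 l0 (ulmin l hl) yB.
rewrite leNgt; apply/negP => hx.
set C0 := (_ `^ (1 / 3)) in hx.
have nR : (4 : R) <= n%:R by rewrite ler_nat.
have lb0 : 0 < lambda_bar R n.+1.
  by rewrite /lambda_bar -natr1 divr_gt0 // !mulr_gt0 //; lra.
have C00 : 0 <= C0 by exact: powR_ge0.
have C03 : C0 ^+ 3 = lambda_star / lambda_bar R n.+1.
  by rewrite cube_rootK // divr_ge0 // ltW.
have x0 : 0 < enorm x.
  rewrite lt_neqAle enorm_ge0 andbT eq_sym; apply/eqP => /enorm_eq0 x0.
  move: hx; rewrite x0 enorm0 powR0 ?mulr0; last by rewrite gt_eqF // divr_gt0.
  by rewrite subr_gt0 ltNge us0.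
have r01 : 0 < enorm x < 1 by rewrite x0.
pose q := enorm x `^ (4 / 3).
have q0 : 0 < q by rewrite powR_gt0.
(* a constant strictly between [C0] and the ratio [(1 - ustar x) / q], so that
   both the equation and the strict inequality at [x] leave some room *)
pose C := (C0 + (1 - ustar x) / q) / 2.
have CC0 : C0 < C by rewrite midf_lt // ltr_pdivlMr.
have Cx : C * q < 1 - ustar x.
  by rewrite -ltr_pdivlMr // midf_lt // ltr_pdivlMr.
have Cgt0 : 0 < C by exact: le_lt_trans CC0.
have C3 : lambda_star < C ^+ 3 * lambda_bar R n.+1.
  rewrite -ltr_pdivrMr // -C03 ltrXn2r //.
(* chosen so that the barrier is a supersolution for [lambda_star] exactly *)
pose e := 1 - lambda_star / (C ^+ 3 * lambda_bar R n.+1).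
have Clb0 : 0 < C ^+ 3 * lambda_bar R n.+1 by rewrite mulr_gt0 // exprn_gt0.
have e01 : 0 < e < 1.
  by rewrite /e subr_gt0 ltr_pdivrMr // mul1r C3 gtrBl divr_gt0.
have eE : (1 - e) * C ^+ 3 * lambda_bar R n.+1 = lambda_star.
  by rewrite /e opprB addrCA subrr addr0 -mulrA divfK // gt_eqF.
have : ustar 0 <= 1 - e * C / 3 * q.
  apply: (cvgr_to_le (ullim 0 B0)).
  have near_x : \forall l \near lambda_star^'-, ul l x < 1 - C * q.
    apply: (cvgr_lt _ (ullim x xB)); lra.
  apply: filterS2 near_ls near_x => l hl ulx; have [l0 lls] := andP hl.
  apply: (center_bound n3 (ulmin l hl) l0 Cgt0 e01 _ r01).
    by rewrite eE ltW.
  rewrite (_ : ul l (enorm x *: axis) = ul l x) //.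
  apply/esym/(minimal_solution_radial (ulmin l hl) xB).
  by rewrite enorm_ray gtr0_norm.
apply/negP; rewrite -ltNge; apply: lt_le_trans us0.
rewrite gtrBl; have [e0 _] := andP e01.
by rewrite mulr_gt0 // divr_gt0 // mulr_gt0.
Unshelve. all: by end_near. Qed.
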